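(* Let $p$ be a strictly positive form in $\mathbb{R}[x]_{3,2d}$. Then $p^2$ lies strictly in the interior of the cone of sums of squares $\Sigma_{3,4d}$.
   Context: $\mathbb{R}[x]_{3,m}$ is the vector space of real forms of degree $m$ in three variables. $\Sigma_{3,4d}\subset\mathbb{R}[x]_{3,4d}$ is the cone of sums of squares of forms in $\mathbb{R}[x]_{3,2d}$; the interior is taken in $\mathbb{R}[x]_{3,4d}$. A form $p$ is strictly positive if $p(x)>0$ for all $x\in\mathbb{R}^3\setminus\{0\}$. *)

(* Defs.v *)
From HB Require Import structures.
From mathcomp Require Import all_boot all_order all_algebra.
From mathcomp Require Import boolp classical_sets reals topology normedtype.
(* The notations of mpoly clash with those of the analysis library. *)
From mathcomp Require Import -(notations) mpoly.

Set Implicit Arguments.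
Unset Strict Implicit.
Unset Printing Implicit Defensive.

Import Order.TTheory GRing.Theory Num.Theory.
Import numFieldNormedType.Exports.
Local Open Scope classical_set_scope.
Local Open Scope ring_scope.

(* The zero polynomial is a form of every degree. *)
Definition ternary_form (R : realType) (m : nat) : Type := dhomog 3 R m.

HB.instance Definition _ (R : realType) (m : nat) :=
  Vector.copy (ternary_form R m) (dhomog 3 R m).

Definition form_coord (R : realType) (m : nat) (p : ternary_form R m) :
  'rV[R]_(dim (ternary_form R m)) := VectorInternalTheory.v2r p.

(* The canonical topology of a finite-dimensional real vector space: the one
   for which a linear isomorphism onto R^N (hence every such isomorphism) is a
   homeomorphism. *)
HB.instance Definition _ (R : realType) (m : nat) :=
  Topological.copy (ternary_form R m) (initial_topology (@form_coord R m)).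

Definition form_eval (R : realType) (m : nat) (p : ternary_form R m)
    (x : 'rV[R]_3) : R :=
  meval (fun i => x 0 i) (mpoly_of_dhomog p).

Definition strictly_positive (R : realType) (m : nat)
    (p : ternary_form R m) : Prop :=
  forall x : 'rV[R]_3, x != 0 -> 0 < form_eval p x.

Lemma form_sqr_is_homog (R : realType) (k : nat) (p : ternary_form R k) :
  mpoly_of_dhomog p ^+ 2 \is ishomog1 (2 * k) mdeg.
Proof. by rewrite mulnC; apply/dhomogMn/dhomog_is_dhomog. Qed.

Definition form_sqr (R : realType) (k : nat) (p : ternary_form R k) :
    ternary_form R (2 * k) :=
  DHomog (form_sqr_is_homog p).

Definition sos_cone (R : realType) (k : nat) : set (ternary_form R (2 * k)) :=
  [set f | exists s : seq (ternary_form R k), f = \sum_(g <- s) form_sqr g].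

(* Main.v *)
Require Import Defs.
From HB Require Import structures.
From mathcomp Require Import all_boot all_order all_algebra.
From mathcomp Require Import boolp classical_sets reals topology normedtype.
From mathcomp Require Import complex ring lra zify.
From mathcomp Require Import -(notations) mpoly.

(* If p^2 is not interior, a separating functional L is nonnegative on squares
   and kills p^2, hence the ideal (p) in degree 4d.  A nonzero positive functional
   killing a form h of degree n without real zeros, and defined in degree 2m with
   m >= n, is impossible, by induction on n.  Moving L within the functionals
   killing h up to the boundary of the positive ones produces a form f of degree m
   outside (h) that is null for L.  A common factor of h and f splits h, and the
   induction hypothesis applies to the two factors.  Otherwise choose the line at
   infinity away from the common zeros of h and f: L extends to the coordinate
   ring of their intersection.  This ring has no real point, so it contains a
   square root I of -1, and multiplication by I shows that L(u^2) takes negative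
   and positive signs equally often: a subspace on which L is nonnegative has at
   most half the dimension of the ring modulo the radical of L.  But counting the
   standard monomials of this quotient degree by degree shows that those of degree
   at most m, on which L is nonnegative, are more than half of them. *)

Set Implicit Arguments.
Unset Strict Implicit.
Unset Printing Implicit Defensive.

Import Order.TTheory GRing.Theory Num.Theory.
Import numFieldNormedType.Exports.

Local Open Scope classical_set_scope.
Local Open Scope ring_scope.


(** * Bivariate polynomials filtered by total degree *)

(** The obstacle is that [L] lives only in degree 2m, so that no quotient ring is at hand in which a
    square root of -1 could act. Coprime leading forms of h and f repair this: they generate all
    forms of high degree, so every polynomial reduces to degree 2m, and an element of the ideal (h,
    f) of degree at most 2m has cofactors without excess degree, so that [L] kills it. The same
    coprimality gives the count. Let s_i be the number of standard monomials of degree i. It starts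
    at 1, grows by at most one per step, and from degree m on falls by at least one until it is 0.
    So the part up to degree m is at least 1 + ... + s_m, the rest at most 1 + ... + (s_m - 1). The
    room m >= n serves the induction: for h = a b, the functional u -> L(a^2 u) is treated in the
    smaller degree 2(m - deg a). Forms are handled as polynomials in x and y, with z = 1. As h does
    not vanish at (0 : 1 : 0), it is monic in y up to a constant, which gives division with
    remainder. *)

Section TotalDegree.
Variable R : idomainType.
Implicit Types (u v : {poly {poly R}}) (w : {poly R}) (c : R) (i j : nat).

(** The inner variable is x and the outer one y, so that [mon a b] is x^a y^b. Only a bound is
    recorded: a form of degree i may be divisible by z. *)
Definition tdeg i u : Prop := forall a b, (i < a + b)%N -> u`_b`_a = 0.

(** The homogeneous part of degree i with x set to 1, as a polynomial in y. Multiplying [u] by x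
    while raising i by one leaves it unchanged. *)
Definition top_form i u : {poly R} := \poly_(b < i.+1) u`_b`_(i - b).

Definition mon a b : {poly {poly R}} := 'X^a *: 'X^b.

Definition form_lift i w : {poly {poly R}} := \sum_(b < i.+1) (w`_b)%:P *: mon (i - b) b.

Lemma coef_mon a b k l : (mon a b)`_l`_k = ((k == a) && (l == b))%:R.
Proof.
rewrite /mon coefZ coefXn; case: (l == b); last by rewrite mulr0 coef0 andbF.
by rewrite mulr1 coefXn andbT.
Qed.

Lemma coefCZ c u a b : (c%:P *: u)`_b`_a = c * u`_b`_a.
Proof. by rewrite coefZ coefCM. Qed.

Lemma mon_expand N u : tdeg N u ->
  u = \sum_(b < N.+1) \sum_(a < N.+1) (u`_b`_a)%:P *: mon a b.
Proof.
move=> du; apply/polyP => l; apply/polyP => k.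
rewrite coef_sum coef_sum.
under eq_bigr => b _.
  rewrite coef_sum coef_sum.
  under eq_bigr => a _ do rewrite coefCZ coef_mon.
  over.
have [lN|lN] := ltnP l N.+1; last first.
  rewrite du; last by lia.
  rewrite big1 // => b _; rewrite big1 // => a _.
  by rewrite (_ : (l == b) = false) ?andbF ?mulr0 //; have := ltn_ord b; lia.
rewrite (bigD1 (Ordinal lN)) //= [X in _ + X]big1 ?addr0; last first.
  move=> b /eqP bl; rewrite big1 // => a _.
  have -> : (l == b) = false by apply/eqP => e; apply: bl; apply: val_inj.
  by rewrite andbF mulr0.
have [kN|kN] := ltnP k N.+1; last first.
  rewrite du; last by lia.
  rewrite big1 // => a _.
  by rewrite (_ : (k == a) = false) ?mulr0 //; have := ltn_ord a; lia.
rewrite (bigD1 (Ordinal kN)) //= [X in _ + X]big1 ?addr0 ?eqxx ?mulr1 //.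
move=> a /eqP ak; have -> : (k == a) = false by apply/eqP => e; apply: ak; apply: val_inj.
by rewrite mulr0.
Qed.

Lemma tdegW i j u : (i <= j)%N -> tdeg i u -> tdeg j u.
Proof. by move=> ij du a b ab; apply: du; lia. Qed.

Lemma tdeg0 i : tdeg i 0.
Proof. by move=> a b _; rewrite !coef0. Qed.

Lemma tdegD i u v : tdeg i u -> tdeg i v -> tdeg i (u + v).
Proof. by move=> du dv a b ab; rewrite !coefD du ?dv ?addr0. Qed.

Lemma tdegN i u : tdeg i u -> tdeg i (- u).
Proof. by move=> du a b ab; rewrite !coefN du ?oppr0. Qed.

Lemma tdegB i u v : tdeg i u -> tdeg i v -> tdeg i (u - v).
Proof. by move=> du dv; apply: tdegD => //; apply: tdegN. Qed.

Lemma tdegCZ i c u : tdeg i u -> tdeg i (c%:P *: u).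
Proof. by move=> du a b ab; rewrite coefCZ du ?mulr0. Qed.

Lemma tdeg_sum i (I : Type) (r : seq I) (Q : pred I) (F : I -> {poly {poly R}}) :
  (forall k, Q k -> tdeg i (F k)) -> tdeg i (\sum_(k <- r | Q k) F k).
Proof.
move=> H; elim/big_rec: _ => [|k u Qk du]; first exact: tdeg0.
by apply: tdegD => //; apply: H.
Qed.

Lemma tdegM i j u v : tdeg i u -> tdeg j v -> tdeg (i + j) (u * v).
Proof.
move=> du dv a b ab; rewrite coefM coef_sum big1 // => k _.
rewrite coefM big1 // => l _.
have [ik|ik] := ltnP i (l + k); first by rewrite du ?mul0r.
have := ltn_ord k; have := ltn_ord l => ? ?.
by rewrite (dv (a - l) (b - k))%N ?mulr0 //; lia.
Qed.

Lemma tdeg_mon i a b : (a + b <= i)%N -> tdeg i (mon a b).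
Proof. by move=> abi k l kl; rewrite coef_mon (_ : _ && _ = false) //;
  apply/negP => /andP[/eqP ? /eqP ?]; lia. Qed.

Lemma monM a b a' b' : mon a b * mon a' b' = mon (a + a') (b + b').
Proof. by rewrite /mon -scalerAl -scalerAr scalerA -!exprD. Qed.

Lemma mon00 : mon 0 0 = 1.
Proof. by rewrite /mon !expr0 scale1r. Qed.

Lemma tdegC i (c : R) : tdeg i c%:P%:P.
Proof.
move=> a b ab; rewrite coefC; case: eqP => [b0|_]; last by rewrite coef0.
by rewrite coefC; case: eqP => // a0; lia.
Qed.

Lemma tdeg1 i : tdeg i 1. Proof. by rewrite -mon00; apply: tdeg_mon. Qed.

Lemma tdeg_exists u : exists N, tdeg N u.
Proof.
exists (\sum_(b < size u) (size (u`_b)%R + b))%N => a b ab.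
have [ub|ub] := ltnP b (size u); last by rewrite (nth_default _ ub) coef0.
rewrite nth_default //; move: ab; rewrite (bigD1 (Ordinal ub)) //=; lia.
Qed.

Lemma coef_top i u b : (top_form i u)`_b = if (b <= i)%N then u`_b`_(i - b) else 0.
Proof. by rewrite coef_poly ltnS. Qed.

Lemma size_top i u : (size (top_form i u) <= i.+1)%N.
Proof. exact: size_poly. Qed.

Lemma topD i u v : top_form i (u + v) = top_form i u + top_form i v.
Proof. by apply/polyP => b; rewrite coefD !coef_top; case: ifP; rewrite ?coefD ?addr0. Qed.

Lemma topCZ i c u : top_form i (c%:P *: u) = c *: top_form i u.
Proof. by apply/polyP => b; rewrite coefZ !coef_top; case: ifP; rewrite ?coefCZ ?mulr0. Qed.

Lemma topN i u : top_form i (- u) = - top_form i u.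
Proof. by apply/polyP => b; rewrite coefN !coef_top; case: ifP; rewrite ?coefN ?oppr0. Qed.

Lemma topM i j u v : tdeg i u -> tdeg j v -> top_form (i + j) (u * v) = top_form i u * top_form j v.
Proof.
move=> du dv; apply/polyP => b; rewrite coef_top; case: leqP => bij; last first.
  rewrite nth_default //; apply: (leq_trans (size_polyMleq _ _)).
  have := size_top i u; have := size_top j v; lia.
rewrite coefM coefM coef_sum; apply: eq_bigr => k _.
have kb := ltn_ord k; rewrite !coef_top coefM.
have [ki|ki] := leqP k i; last first.
  by rewrite mul0r big1 // => l _; rewrite du ?mul0r //; lia.
have lt : (i - k < (i + j - b).+1)%N \/ (j < b - k)%N by lia.
case: lt => [lt|lt]; last first.
  rewrite leqNgt lt /= mulr0 big1 // => l _; rewrite (dv _ (b - k)%N) ?mulr0 //.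
  lia.
rewrite (bigD1 (Ordinal lt)) //= big1 ?addr0; last first.
  move=> l lk; have {}lk : (l : nat) <> (i - k)%N.
    by move=> e; case/eqP: lk; apply: val_inj.
  have := ltn_ord l => ?.
  have [il|il] := ltnP i (l + k); first by rewrite du ?mul0r.
  by rewrite (dv _ (b - k)%N) ?mulr0 //; lia.
have -> : (b - k <= j)%N by lia.
by congr (_ * _`_ _); lia.
Qed.

Lemma tdeg_top0 i u : tdeg i.+1 u -> top_form i.+1 u = 0 -> tdeg i u.
Proof.
move=> du t0 a b ab; have [|e] := ltnP i.+1 (a + b); first exact: du.
have := congr1 (fun q : {poly R} => q`_b) t0; rewrite coef_top coef0.
have -> : (b <= i.+1)%N by lia.
by have -> : (i.+1 - b = a)%N by lia.
Qed.

Lemma tdeg0_top0 u : tdeg 0 u -> top_form 0 u = 0 -> u = 0.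
Proof.
move=> du t0; apply/polyP => b; apply/polyP => a; rewrite !coef0.
have [|e] := ltnP 0 (a + b); first exact: du.
have := congr1 (fun q : {poly R} => q`_0) t0; rewrite coef_top coef0 /= subn0.
have a0 : (a = 0)%N by lia. have b0 : (b = 0)%N by lia. by rewrite a0 b0.
Qed.

Lemma top_lt i j u : tdeg i u -> (i < j)%N -> top_form j u = 0.
Proof.
move=> du ij; apply/polyP => b; rewrite coef_top coef0; case: ifP => // bj.
by apply: du; lia.
Qed.

Lemma top_mon a b : top_form (a + b) (mon a b) = 'X^b.
Proof.
apply/polyP => l; rewrite coef_top coefXn coef_mon.
case: leqP => lab; last by rewrite (_ : l == b = false) //; apply/eqP; lia.
case: (eqVneq l b) => [->|]; last by rewrite andbF.
by rewrite addnK eqxx.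
Qed.

Lemma exact_tdeg u : u != 0 -> exists i, tdeg i u /\ top_form i u != 0.
Proof.
move=> u0; have [N] := tdeg_exists u; elim: N => [|N IH] dN.
  by exists 0%N; split=> //; apply: contra_neq u0; apply: tdeg0_top0.
case: (eqVneq (top_form N.+1 u) 0) => [t0|]; last by exists N.+1.
exact: IH (tdeg_top0 dN t0).
Qed.

Lemma tdeg_hom i w : tdeg i (form_lift i w).
Proof.
apply: tdeg_sum => b _; apply/tdegCZ/tdeg_mon; have := ltn_ord b; lia.
Qed.

Lemma top_hom i w : (size w <= i.+1)%N -> top_form i (form_lift i w) = w.
Proof.
move=> sw; apply/polyP => l; rewrite coef_top; case: leqP => li; last first.
  by rewrite nth_default //; apply: leq_trans sw li.
rewrite coef_sum coef_sum.
under eq_bigr => b _ do rewrite coefCZ coef_mon.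
have lt : (l < i.+1)%N by [].
rewrite (bigD1 (Ordinal lt)) //= big1 ?eqxx ?mulr1 ?addr0 //.
move=> b bl; rewrite (_ : (l == b) = false) ?andbF ?mulr0 //.
by apply/eqP => e; case/eqP: bl; apply: val_inj.
Qed.

End TotalDegree.

(** * Gauss's lemma *)

Section Gauss.
Variable F : fieldType.
Implicit Types (u v h f g : {poly {poly F}}) (p q c : {poly F}).

Lemma irreducible_divisor p : (1 < size p)%N ->
  exists2 q, irreducible_poly q & q %| p.
Proof.
have [k] := ubnP (size p); elim: k p => // k IH p pk p1.
have [irr|nirr] := EM (irreducible_poly p : Prop); first by exists p.
have [q /not_implyP[q1 /not_implyP[qp nqp]]] :
    exists q : {poly F}, ~ (size q != 1%N -> q %| p -> q %= p).
  by apply/existsNP => H; apply: nirr; split.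
have p0 : p != 0 by rewrite -size_poly_gt0 ltnW.
have q0 : q != 0 by apply: contraNneq p0 => q0; move: qp; rewrite q0 dvd0p.
have sq : (size q < size p)%N.
  rewrite ltn_neqAle (dvdp_leq p0 qp) andbT dvdp_size_eqp //.
  exact/negP.
have [||r ri rq] := IH q.
- by apply: leq_trans sq _; rewrite -ltnS.
- by rewrite ltn_neqAle eq_sym q1 size_poly_gt0.
- by exists r => //; apply: dvdp_trans qp.
Qed.

Lemma irreducible_dvdM p q r : irreducible_poly p -> p %| q * r -> (p %| q) || (p %| r).
Proof.
move=> ip; have [//|] := boolP (p %| q).
by rewrite -(irreducible_poly_coprime q ip) => cop; rewrite Gauss_dvdpr.
Qed.

(** Gauss's argument: if the first coefficients that [p] does not divide are at i in [u] and at j in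
    [v], then [p] does not divide coefficient i + j of the product. *)
Lemma primitive_mul p u v : irreducible_poly p ->
  (forall i, p %| (u * v)`_i) -> (forall i, p %| u`_i) \/ (forall i, p %| v`_i).
Proof.
move=> ip uv.
have cases w : (forall i, p %| w`_i) \/
    exists2 i, ~~ (p %| w`_i) & forall j, (j < i)%N -> p %| w`_j.
  have [hw|] := boolP (has (fun c => ~~ (p %| c)) w); last first.
    rewrite -all_predC => /allP aw; left => i.
    have [iw|iw] := ltnP i (size w); last by rewrite nth_default ?dvdp0.
    by have /= := aw _ (mem_nth 0 iw); rewrite negbK.
  right; exists (find (fun c => ~~ (p %| c)) w); first exact: (nth_find 0 hw).
  by move=> j /(before_find 0) /negbFE.
case: (cases u) => [|[i ui ltu]]; first by left.
case: (cases v) => [|[j vj ltv]]; first by right.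
have := uv (i + j)%N; rewrite coefM.
have ii : (i < (i + j).+1)%N by lia.
rewrite (bigD1 (Ordinal ii)) //= addKn dvdp_addl.
  by move=> /(irreducible_dvdM ip); rewrite (negbTE ui) (negbTE vj).
apply: (big_ind (fun x : {poly F} => p %| x)) => [|x y dx dy|k ki];
  [exact: dvdp0|by rewrite dvdp_addr|].
have [ltk|] := ltnP k i; first exact/dvdp_mulr/ltu.
rewrite leq_eqVlt => /orP[/eqP e|gtk]; last by apply/dvdp_mull/ltv; have := ltn_ord k; lia.
by case/eqP: ki; apply: val_inj.
Qed.

Lemma dvd_coefs p u : (forall i, p %| u`_i) -> exists v, u = p *: v.
Proof.
move=> pu; exists (map_poly (fun c => c %/ p) u); apply/polyP => i.
by rewrite coefZ coef_map_id0 ?div0p // mulrC divpK.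
Qed.

(** The irreducible factors of [c] are cancelled one at a time, each from [u] or from [v]. They are
    free of y, so the sizes do not change. *)
Lemma gauss_clear_content c h u v : c != 0 -> lead_coef h = 1 -> c *: h = u * v ->
  exists u1 v1, [/\ size u1 = size u, size v1 = size v & h = u1 * v1].
Proof.
have [k] := ubnP (size c); elim: k c u v => // k IH c u v ck c0 lh e.
have [c1|c1] := leqP (size c) 1.
  have [d dE] : exists d, c = d%:P by exists c`_0; apply: size1_polyC.
  have d0 : d != 0 by move: c0; rewrite dE polyC_eq0.
  exists ((d^-1)%:P *: u), v; split => //.
    by rewrite size_scale // polyC_eq0 invr_eq0.
  by rewrite -scalerAl -e dE scalerA -polyCM mulVf // scale1r.
have [p ip pc] := irreducible_divisor c1.
have p0 := irredp_neq0 ip.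
have pC0 : p%:P != 0 by rewrite polyC_eq0.
have cE : c = p * (c %/ p) by rewrite mulrC divpK.
have sc : (size (c %/ p)%R < k)%N.
  rewrite size_divp //; move: ck c1 (ip.1).
  by move: (size c) (size p) => x y; lia.
have cp0 : c %/ p != 0 by rewrite dvdp_div_eq0.
have [|pu|pv] := primitive_mul (u := u) (v := v) ip.
- by move=> i; rewrite -e coefZ dvdp_mulr.
- have [u' uE] := dvd_coefs pu.
  have [|u1 [v1 [s1 s2 hE]]] := IH (c %/ p) u' v sc cp0 lh.
    by apply: (mulfI pC0); rewrite !mul_polyC scalerA -cE e uE scalerAl.
  by exists u1, v1; split; rewrite ?s1 // uE size_scale.
- have [v' vE] := dvd_coefs pv.
  have [|u1 [v1 [s1 s2 hE]]] := IH (c %/ p) u v' sc cp0 lh.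
    by apply: (mulfI pC0); rewrite !mul_polyC scalerA -cE e vE scalerAr.
  by exists u1, v1; split; rewrite ?s2 // vE size_scale.
Qed.

(** The resultant eliminates y. If it vanishes, [h] and [f] share a factor of positive degree in y
    over the fraction field, and Gauss's lemma brings the factorization of [h] back to
    polynomials. *)
Lemma coprime_or_factor h f : h \is monic -> (1 < size h)%N ->
    ~ (exists g, f = g * h) ->
  (exists a b r, r != 0 /\ a * h + b * f = r%:P) \/
  (exists a b, [/\ h = a * b, (1 < size a < size h)%N & (1 < size b < size h)%N]).
Proof.
move=> mh h1 nf; have lh : lead_coef h = 1 by apply/eqP; rewrite -monicE.
have h0 := monic_neq0 mh.
have f0 : f != 0 by apply/eqP => f0; apply: nf; exists 0; rewrite mul0r.
have [f1|f1] := leqP (size f) 1.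
  left; exists 0, 1, f`_0; rewrite mul0r add0r mul1r -(size1_polyC f1); split => //.
  by move: f0; rewrite [in X in X -> _](size1_polyC f1) polyC_eq0.
case: (eqVneq (resultant h f) 0) => [r0|r0]; last first.
  have [[a b] /= _ e] := resultant_in_ideal h1 f1.
  by left; exists a, b, (resultant h f); rewrite -e.
right; have := resultant_eq0 h f; rewrite r0 eqxx => /esym g1.
set g := gcdp h f in g1.
have /Pdiv.Idomain.dvdpP[[c q] /= c0 hE] : g %| h by exact: dvdp_gcdl.
have /Pdiv.Idomain.dvdpP[[c' q'] /= c'0 fE] : g %| f by exact: dvdp_gcdr.
have g0 : g != 0 by rewrite -size_poly_gt0 ltnW.
have q0 : q != 0.
  by apply/eqP => q0; move/eqP: hE;
    rewrite q0 mul0r -mul_polyC mulf_eq0 polyC_eq0 (negbTE c0) (negbTE h0).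
have sz : (size h).+1 = (size q + size g)%N.
  rewrite -(size_scale h c0) hE size_mul // prednK // addn_gt0.
  by rewrite size_poly_gt0 q0.
have [q1|q1] := leqP (size q) 1; last first.
  have [a [b [sa sb e]]] := gauss_clear_content c0 lh hE.
  exists a, b; rewrite sa sb; move: sz q1 g1.
  by move: (size h) (size q) (size g) => x y z; split => //; lia.
(* If [q] were free of y, [h] would divide a multiple of [f] by a nonzero polynomial in x. It would
   then divide the same multiple of the remainder of [f], whose degree in y is too small. *)
exfalso; have [d dE] : exists d, q = d%:P by exists q`_0; apply: size1_polyC.
have d0 : d != 0 by move: q0; rewrite dE polyC_eq0.
have key : (d * c') *: f = (c *: q') * h.
  by rewrite -scalerA fE -scalerAl scalerAr scalerAr -scalerAr hE dE mul_polyC scalerAr.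
have rE := Pdiv.IdomainMonic.divp_eq mh f.
set r := f %% h in rE.
have r0' : r != 0.
  by apply/eqP => r0'; apply: nf; exists (f %/ h); rewrite [LHS]rE r0' addr0.
pose W := c *: q' - (d * c') *: (f %/ h).
have e : (d * c') *: r = W * h.
  by rewrite mulrBl -key -scalerAl [X in _ *: X - _]rE scalerDr addrC addKr.
have W0 : W != 0.
  apply/eqP => W0; move/eqP: e; rewrite W0 mul0r -mul_polyC mulf_eq0 polyC_eq0.
  by rewrite mulf_eq0 (negbTE d0) (negbTE c'0) (negbTE r0').
have se : size r = (size W + size h).-1.
  by rewrite -size_Mmonic // -e size_scale ?mulf_neq0.
have : (size r < size h)%N by rewrite ltn_modp.
rewrite se; move: W0; rewrite -size_poly_gt0.
by case: (size W) => // x _; rewrite addSn /= ltnNge leq_addl.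
Qed.

End Gauss.

(** * Square roots of -1 on a curve without real points *)

Section SqrtMinusOne.
Variable A : comUnitRingType.
Hypothesis unit2 : (2%:R : A) \is a GRing.unit.
Implicit Types h g : A.

Definition ideal2 h g (u : A) : Prop := exists a b, u = a * h + b * g.

Definition has_sqrtN1 h g : Prop := exists I, ideal2 h g (I ^+ 2 + 1).

Lemma sqrtN1_dvd h g k : has_sqrtN1 h (k * g) -> has_sqrtN1 h g.
Proof. by move=> [I [a [b e]]]; exists I, a, (b * k); rewrite e mulrA. Qed.

(* Newton's step for I^2 + 1, corrected to avoid inverting I. *)
Lemma sqrtN1_sqr h g : has_sqrtN1 h g -> has_sqrtN1 h (g ^+ 2).
Proof.
move=> [I [a [b e]]]; pose eta := I ^+ 2 + 1; pose c : A := 2%:R^-1.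
have c2 : 2%:R * c = 1 by rewrite /c mulrV.
pose k := 1 - c ^+ 2 + c ^+ 2 * eta.
exists (I + c * eta * I), (k * (a ^+ 2 * h + 2%:R * a * b * g)), (k * b ^+ 2).
have -> : (I + c * eta * I) ^+ 2 + 1 =
    eta ^+ 2 * k + (1 - 2%:R * c) * (eta - eta ^+ 2) by rewrite /k /eta; ring.
by rewrite c2 subrr mul0r addr0 {1}/eta e; ring.
Qed.

(** Chinese remainders: the new root is [I1] modulo [g1] and [I2] modulo [g2]. *)
Lemma sqrtN1_mul h g1 g2 s t : s * g1 + t * g2 = 1 ->
  has_sqrtN1 h g1 -> has_sqrtN1 h g2 -> has_sqrtN1 h (g1 * g2).
Proof.
move=> st [I1 [a1 [b1 e1]]] [I2 [a2 [b2 e2]]].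
have tE : t * g2 = 1 - s * g1 by rewrite -st addrC addKr.
exists (I1 * (t * g2) + I2 * (s * g1)), (a1 * (t * g2) ^+ 2 + a2 * (s * g1) ^+ 2),
  (b1 * t ^+ 2 * g2 + b2 * s ^+ 2 * g1 + 2%:R * s * t * (I1 * I2 + 1)).
have -> : (I1 * (t * g2) + I2 * (s * g1)) ^+ 2 + 1 =
  (I1 ^+ 2 + 1) * (t * g2) ^+ 2 + (I2 ^+ 2 + 1) * (s * g1) ^+ 2
  + 2%:R * (s * g1) * (t * g2) * (I1 * I2 + 1) by rewrite tE; ring.
by rewrite e1 e2; ring.
Qed.

End SqrtMinusOne.

Lemma sqrtN1_irreducible_factors (F : fieldType) (A : comUnitRingType)
    (phi : {rmorphism {poly F} -> A}) (h : A) (r : {poly F}) :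
  (2%:R : A) \is a GRing.unit ->
  (forall p, irreducible_poly p -> p %| r -> has_sqrtN1 h (phi p)) ->
  r != 0 -> has_sqrtN1 h (phi r).
Proof.
move=> u2; have [k] := ubnP (size r); elim: k r => // k IH r rk H r0.
have [r1|r1] := leqP (size r) 1.
  have [d dE] : exists d, r = d%:P by exists r`_0; apply: size1_polyC.
  have d0 : d != 0 by move: r0; rewrite dE polyC_eq0.
  exists 0, 0, (phi (d^-1)%:P); rewrite dE -rmorphM -polyCM mulVf // rmorph1; ring.
have [p ip pr] := irreducible_divisor r1.
have rE : r = (r %/ p) * p by rewrite divpK.
set q := r %/ p in rE.
have q0 : q != 0 by rewrite dvdp_div_eq0.
have sq : (size q < k)%N.
  rewrite size_divp ?irredp_neq0 //; move: rk r1 (ip.1).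
  by move: (size r) (size p) => x y; lia.
have Hq : has_sqrtN1 h (phi q).
  by apply: IH => // p' ip' p'q; apply: H => //; rewrite rE dvdp_mulr.
(* If [p] divides [q] again, then [r] divides q^2 and the squaring step suffices. *)
have [/divpK pq|npq] := boolP (p %| q).
  apply: (@sqrtN1_dvd _ _ _ (phi (q %/ p))).
  rewrite -rmorphM [in X in phi (_ * X)]rE mulrCA pq mulrC -expr2 rmorphXn.
  exact: sqrtN1_sqr.
have /Bezout_eq1_coprimepP[[s t] /= st] : coprimep q p.
  by rewrite coprimep_sym irreducible_poly_coprime.
rewrite rE rmorphM; apply: (@sqrtN1_mul _ _ _ _ (phi s) (phi t)) => //.
  by rewrite -!rmorphM -rmorphD st rmorph1.
exact: H.
Qed.

Section RealClosed.
Variable R : rcfType.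

(** A complex root a + b i of [p] has b nonzero, so [p] divides (X - a)^2 + b^2, and (X - a) / b is
    the required root. *)
Lemma irreducible_sqrtN1 (p : {poly R}) : irreducible_poly p ->
  (forall x, ~~ root p x) -> has_sqrtN1 0 p.
Proof.
move=> ip nr; pose f := real_complex R.
have /closed_rootP[[a b] rz] : size (map_poly f p) != 1.
  by rewrite size_map_poly gtn_eqF // ip.1.
have fab : (a +i* b)%C = f a + f b * 'i%C :> R[i].
  by apply/eqP; rewrite eq_complex /= !(mulr0, mul0r, mulr1, mul1r, addr0, add0r, subr0) !eqxx.
pose Q : {poly R} := ('X - a%:P) ^+ 2 + (b ^+ 2)%:P.
have rQ : root (map_poly f Q) (a +i* b)%C.
  rewrite /root rmorphD rmorphXn /= rmorphB /= map_polyX !map_polyC /= !hornerE fab.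
  rewrite addrAC subrr add0r exprMn sqr_i mulrN1 rmorphXn /= addNr //.
have b0 : b != 0.
  apply: contraNneq (nr a) => b0; move: rz.
  have -> : (a +i* b)%C = f a by rewrite b0.
  by rewrite fmorph_root.
have pQ : p %| Q.
  apply: contraTT rQ => npQ; have := npQ.
  rewrite -(irreducible_poly_coprime Q ip) -(coprimep_map f).
  by move=> /coprimep_root /(_ rz).
have /dvdpP[q qE] := pQ.
exists ((b^-1)%:P * ('X - a%:P)), 0, (((b ^+ 2)^-1)%:P * q).
rewrite mul0r add0r -mulrA -qE /Q exprMn mulrDr -rmorphXn /= exprVn -polyCM mulVf //.
by rewrite expf_neq0.
Qed.

Lemma unit2_poly : (2%:R : {poly R}) \is a GRing.unit.
Proof.
by rewrite -(rmorph_nat (@polyC R)) poly_unitE size_polyC coefC /= pnatr_eq0 /= unitfE pnatr_eq0.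
Qed.

Lemma unit2_poly2 : (2%:R : {poly {poly R}}) \is a GRing.unit.
Proof.
rewrite -(rmorph_nat (@polyC {poly R})) poly_unitE size_polyC coefC /= unit2_poly andbT.
by rewrite -(rmorph_nat (@polyC R)) polyC_eq0 pnatr_eq0.
Qed.

Lemma sqrtN1_rootless (r : {poly R}) : r != 0 -> (forall x, ~~ root r x) -> has_sqrtN1 0 r.
Proof.
move=> r0 nr; apply: (@sqrtN1_irreducible_factors R {poly R} idfun 0 r unit2_poly) => //.
move=> p ip pr; apply: irreducible_sqrtN1 => // x; apply: contra (nr x).
by move=> /(root_dvdp pr).
Qed.

Definition eval2 (u : {poly {poly R}}) (x y : R) : R := u.[y%:P].[x].

(** It is enough to treat the irreducible factors of [r]. One without real root has a square root of
    -1 in x alone; for x - x0, the univariate h(x0, y) has no real root and supplies one in y. *)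
Lemma sqrtN1_curve (h : {poly {poly R}}) (r : {poly R}) :
  (forall x y, eval2 h x y != 0) -> r != 0 -> has_sqrtN1 h r%:P.
Proof.
move=> nh r0.
suff H p : irreducible_poly p -> has_sqrtN1 h p%:P.
  have := @sqrtN1_irreducible_factors R {poly {poly R}} (@polyC {poly R}) h r unit2_poly2.
  by apply=> // p ip _; apply: H.
move=> ip; have [/existsNP[x /negP/negPn rx]|nr] := EM (~ forall x, ~~ root p x).
  have pE : 'X - x%:P %= p.
    by apply: ip.2; rewrite ?size_XsubC ?dvdp_XsubCl.
  suff [I [a [b e]]] : has_sqrtN1 h ('X - x%:P)%:P.
    have /dvdpP[k kE] : p %| 'X - x%:P by case/andP: pE.
    by exists I, a, (b * k%:P); rewrite e -mulrA -polyCM -kE.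
  pose ha : {poly R} := map_poly (horner_eval x) h.
  have hay y : ha.[y] = eval2 h x y.
    by rewrite /ha /eval2 -[LHS]/(_.[y]) -{1}(hornerC y x) -/(horner_eval x _) horner_map.
  have ha0 : ha != 0.
    by apply/eqP => e; have := nh x 0; rewrite -hay e horner0 eqxx.
  have [|I [a [b e]]] := sqrtN1_rootless ha0.
    by move=> y; rewrite /root hay.
  have [w wE] : exists w, h - map_poly polyC ha = ('X - x%:P) *: w.
    apply: dvd_coefs => i; rewrite coefB !coef_map /= dvdp_XsubCl.
    by rewrite /root !hornerE /horner_eval subrr.
  exists (map_poly polyC I), (map_poly polyC b), (- (map_poly polyC b) * w).
  have -> : map_poly polyC I ^+ 2 + 1 = map_poly polyC (I ^+ 2 + 1) :> {poly {poly R}}.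
    by rewrite rmorphD rmorphXn rmorph1.
  rewrite e mulr0 add0r rmorphM /= -mulrA -(mulrC _ w) mul_polyC -wE; ring.
have {}nr : forall x, ~~ root p x by apply: contrapT.
have [I [a [b e]]] := irreducible_sqrtN1 ip nr.
have eP := congr1 (@polyC {poly R}) e.
by exists I%:P, 0, b%:P; rewrite mul0r add0r -polyCM -polyC_exp -polyC1 -polyCD eP mulr0 add0r.
Qed.

End RealClosed.

(** * Positive functionals *)

Section Functional.
Variable R : realFieldType.
Implicit Types (u v w : {poly {poly R}}) (c t : R) (L : {poly {poly R}} -> R).

Definition functional L : Prop := forall c u v, L (c%:P *: u + v) = c * L u + L v.

Section Theory.
Variable L : {poly {poly R}} -> R.
Hypothesis linL : functional L.

Lemma functional0 : L 0 = 0.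
Proof.
by have := linL 1 0 0; rewrite scaler0 addr0 mul1r => /eqP;
  rewrite -subr_eq0 opprD addNKr oppr_eq0 => /eqP.
Qed.

Lemma functionalD u v : L (u + v) = L u + L v.
Proof. by have := linL 1 u v; rewrite scale1r mul1r. Qed.

Lemma functionalZ c u : L (c%:P *: u) = c * L u.
Proof. by have := linL c u 0; rewrite !addr0 functional0 addr0. Qed.

Lemma functionalN u : L (- u) = - L u.
Proof. by have := functionalZ (-1) u; rewrite polyCN scaleN1r mulN1r. Qed.

Lemma functionalB u v : L (u - v) = L u - L v.
Proof. by rewrite functionalD functionalN. Qed.

Lemma functional_sum (J : Type) (r : seq J) (Q : pred J) (F : J -> {poly {poly R}}) :
  L (\sum_(k <- r | Q k) F k) = \sum_(k <- r | Q k) L (F k).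
Proof. exact: (big_morph L functionalD functional0). Qed.

Lemma functional_mul u : functional (fun v => L (u * v)).
Proof. by move=> c v w; rewrite mulrDr -scalerAr linL. Qed.

Lemma functional_mono u v : (forall a b, u`_b`_a != 0 -> L (mon R a b * v) = 0) -> L (u * v) = 0.
Proof.
move=> H; have [N dN] := tdeg_exists u; rewrite (mon_expand dN) mulr_suml functional_sum.
rewrite big1 // => b _; rewrite mulr_suml functional_sum big1 // => a _.
rewrite -scalerAl functionalZ; have [->|/H->] := eqVneq (u`_b`_a) 0; first by rewrite mul0r.
by rewrite mulr0.
Qed.

Lemma psd_null u w : (forall t, 0 <= L ((u + t%:P *: w) ^+ 2)) -> L (u ^+ 2) = 0 ->
  L (u * w) = 0.
Proof.
move=> psd u0; pose x := L (u * w); pose y := L (w ^+ 2).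
have q t : 0 <= 2%:R * t * x + t ^+ 2 * y.
  have -> : 2%:R * t * x + t ^+ 2 * y = L ((u + t%:P *: w) ^+ 2); last exact: psd.
  have -> : (u + t%:P *: w) ^+ 2 = u ^+ 2 + (2%:R * t)%:P *: (u * w) + (t ^+ 2)%:P *: w ^+ 2.
    by rewrite -!mul_polyC polyCM rmorphXn rmorphM /= !rmorph_nat; ring.
  by rewrite !functionalD !functionalZ u0 add0r.
rewrite -/x; have y0 : 0 <= y.
  have := q 1; have := q (-1); rewrite -/x; nra.
(* The minimizer - x / y, with y + 1 in place of y so that y = 0 needs no separate case. *)
have := q (- x / (y + 1)).
have y1 : 0 < y + 1 by lra.
have -> : 2%:R * (- x / (y + 1)) * x + (- x / (y + 1)) ^+ 2 * y =
  - (x ^+ 2 * (y + 2%:R) / (y + 1) ^+ 2) by field; rewrite gt_eqF.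
rewrite oppr_ge0 pmulr_lle0 ?invr_gt0 ?exprn_gt0 // pmulr_lle0; last lra.
by move=> x2; apply/eqP; rewrite -sqrf_eq0 -/x eq_le x2 sqr_ge0.
Qed.

(** The kernel of the bilinear form (u, v) -> L(u v) on the whole polynomial ring; it is an
    ideal. *)
Definition radical u : Prop := forall v, L (u * v) = 0.

Lemma radicalD u v : radical u -> radical v -> radical (u + v).
Proof. by move=> ru rv w; rewrite mulrDl functionalD ru rv addr0. Qed.

Lemma radicalM u v : radical u -> radical (u * v).
Proof. by move=> ru w; rewrite -mulrA ru. Qed.

Lemma radicalCZ c u : radical u -> radical (c%:P *: u).
Proof. by move=> ru w; rewrite -scalerAl functionalZ ru mulr0. Qed.

Lemma radicalB u v : radical u -> radical v -> radical (u - v).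
Proof. by move=> ru rv w; rewrite mulrBl functionalB ru rv subr0. Qed.

Lemma radical0 : radical 0.
Proof. by move=> w; rewrite mul0r functional0. Qed.

Lemma radical_sum (J : Type) (r : seq J) (Q : pred J) (F : J -> {poly {poly R}}) :
  (forall k, Q k -> radical (F k)) -> radical (\sum_(k <- r | Q k) F k).
Proof.
move=> H; elim/big_rec: _ => [|k u Qk]; first exact: radical0.
exact/radicalD/H.
Qed.

Definition lcomb (s : seq {poly {poly R}}) (c : 'rV[R]_(size s)) : {poly {poly R}} :=
  \sum_(j < size s) (c 0 j)%:P *: s`_j.

Lemma lcombP (s : seq {poly {poly R}}) k (c d : 'rV[R]_(size s)) :
  lcomb (k *: c + d) = k%:P *: lcomb c + lcomb d.
Proof.
rewrite scaler_sumr -big_split; apply: eq_bigr => j _ /=.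
by rewrite !mxE polyCD polyCM scalerDl scalerA.
Qed.

(* Multiplication by a square root of -1 modulo the radical reverses the sign
   of the form, so no positive semidefinite subspace exceeds half the rank. *)
Lemma psd_half_rank I (e g : seq {poly {poly R}}) :
  radical (I ^+ 2 + 1) ->
  (forall c : 'rV_(size e), 0 <= L (lcomb c ^+ 2)) ->
  (forall c : 'rV_(size e), radical (lcomb c) -> c = 0) ->
  (forall u, exists (a : 'rV_(size e)) (b : 'rV_(size g)), radical (u - (lcomb a + lcomb b))) ->
  (size e <= size g)%N.
Proof.
move=> II psd indep gen; rewrite leqNgt; apply/negP => ge.
have lcomb_row s (c : 'rV_(size s)) v : L (lcomb c * v) = \sum_j c 0 j * L (s`_j * v).
  rewrite mulr_suml functional_sum; apply: eq_bigr => j _.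
  by rewrite -scalerAl functionalZ.
have /choice[a /choice[b abP]] : forall i : 'I_(size e),
    exists (a : 'rV_(size e)) (b : 'rV_(size g)),
    radical (I * e`_i - (lcomb a + lcomb b)) by move=> i; apply: gen.
pose A : 'M_(size e) := \matrix_i a i.
pose B : 'M_(size e, size g) := \matrix_i b i.
pose G : 'M_(size e, size g) := \matrix_(i, j) L (e`_i * g`_j).
(* For [c] in the kernel of [B], [I * u] is modulo the radical a combination [u'] of [e]. As L(u^2)
   and L(u'^2) = - L(u^2) are both nonnegative, they are 0, and [u] and [u'] are orthogonal to [e].
   Pairing [u] with [I * e_k] then shows that it is orthogonal to the [g]-part of [I * e_k]. *)
have step (c : 'rV_(size e)) : c *m B = 0 ->
    (forall l : 'I_(size e), L (lcomb c * e`_l) = 0) /\ c *m G *m B^T = 0.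
  move=> cB; set u := lcomb c; pose u' := lcomb (c *m A).
  have lin s (f : 'I_(size e) -> 'rV_(size s)) :
      lcomb (c *m \matrix_i f i) = \sum_i (c 0 i)%:P *: lcomb (f i).
    rewrite /lcomb; under [RHS]eq_bigr => i _ do rewrite scaler_sumr.
    rewrite exchange_big; apply: eq_bigr => j _ /=.
    rewrite mxE rmorph_sum scaler_suml; apply: eq_bigr => i _ /=.
    by rewrite mxE polyCM scalerA.
  have rIu : radical (I * u - u').
    have -> : I * u - u' = \sum_i (c 0 i)%:P *: (I * e`_i - (lcomb (a i) + lcomb (b i))).
      under eq_bigr => i _ do rewrite scalerBr scalerDr.
      rewrite sumrB big_split /= -!lin -/A -/B cB.
      have -> : lcomb (0 : 'rV_(size g)) = 0.
        by rewrite /lcomb big1 // => j _; rewrite mxE scale0r.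
      rewrite addr0; congr (_ - _).
      by rewrite mulr_sumr; apply: eq_bigr => j _; rewrite scalerAr.
    by apply: radical_sum => i _; apply: radicalCZ.
  have Iu2 : L ((I * u) ^+ 2) = - L (u ^+ 2).
    have := II (u ^+ 2); rewrite mulrDl mul1r functionalD -exprMn => /eqP.
    by rewrite addr_eq0 => /eqP.
  have u'2 : L (u' ^+ 2) = L ((I * u) ^+ 2).
    have := rIu (I * u + u'); rewrite -subr_sqr functionalB => /eqP.
    by rewrite subr_eq0 => /eqP.
  have u20 : L (u ^+ 2) = 0.
    apply: le_anti; rewrite psd andbT -oppr_ge0 -Iu2 -u'2; exact: psd.
  have null (d : 'rV_(size e)) : L (lcomb d ^+ 2) = 0 ->
      forall l : 'I_(size e), L (lcomb d * e`_l) = 0.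
    move=> d0 l; apply: psd_null => // t.
    have -> : lcomb d + t%:P *: e`_l = lcomb (t *: delta_mx 0 l + d).
      rewrite lcombP addrC; congr (_ *: _ + _).
      rewrite /lcomb (bigD1 l) //= big1 ?addr0 ?mxE ?eqxx ?scale1r //.
      by move=> j jl; rewrite mxE eqxx (negbTE jl) scale0r.
    exact: psd.
  split; first exact: null.
  apply/rowP => k; rewrite !mxE.
  transitivity (\sum_(j < size g) L (u * g`_j) * b k 0 j).
    apply: eq_bigr => j _; rewrite !mxE; congr (_ * _).
    by rewrite lcomb_row; apply: eq_bigr => l _; rewrite mxE.
  transitivity (L (u * lcomb (b k))).
    rewrite mulr_sumr functional_sum; apply: eq_bigr => j _.
    by rewrite -scalerAr functionalZ mulrC.
  have := abP k u; rewrite mulrC mulrBr functionalB mulrDr functionalD.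
  have -> : L (u * (I * e`_k)) = 0.
    have := rIu e`_k; rewrite mulrBl functionalB null ?subr0; first by rewrite mulrCA mulrA.
    by rewrite -/u' u'2 Iu2 u20 oppr0.
  have -> : L (u * lcomb (a k)) = 0.
    rewrite [u * _]mulrC lcomb_row big1 // => l _.
    by rewrite [_ * u]mulrC null ?mulr0.
  by rewrite !add0r => /eqP; rewrite oppr_eq0 => /eqP.
have NGB : kermx B *m G *m B^T = 0.
  apply/row_matrixP => i; rewrite row0 2!row_mul; apply: (step _ _).2.
  by rewrite -row_mul mulmx_ker row0.
(* The kernel of [B] has dimension size e - rank B, and [G] has rank at most size g - rank B on it.
   If size e > size g, a nonzero vector is killed by both: it is orthogonal to [e] and to [g], hence
   in the radical. *)
have r1 := mulmx0_rank_max NGB; rewrite mxrank_tr in r1.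
have r2 := mxrank_mul_ker (kermx B) G; rewrite mxrank_ker in r2.
have rB := rank_leq_row B.
have nz : (kermx B :&: kermx G)%MS != 0.
  by rewrite -mxrank_eq0; apply/eqP => r0; move: r2; rewrite r0; lia.
have [c [c0 cN cG]] : exists c : 'rV_(size e), [/\ c != 0, c *m B = 0 & c *m G = 0].
  exists (nz_row (kermx B :&: kermx G)%MS); rewrite nz_row_eq0; split => //.
    by apply/sub_kermxP; rewrite (submx_trans (nz_row_sub _)) ?capmxSl.
  by apply/sub_kermxP; rewrite (submx_trans (nz_row_sub _)) ?capmxSr.
case/eqP: c0; apply: indep => v; set u := lcomb c.
have [ue _] := step _ cN.
have [av [bv rv]] := gen v.
have := rv u; rewrite mulrC mulrBr functionalB => /eqP; rewrite subr_eq0 => /eqP ->.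
rewrite mulrDr functionalD [u * lcomb av]mulrC lcomb_row big1 ?add0r; last first.
  by move=> l _; rewrite [_ * u]mulrC ue mulr0.
rewrite [u * _]mulrC lcomb_row big1 // => j _.
have := congr1 (fun M : 'rV_(size g) => M 0 j) cG; rewrite [LHS]mxE [RHS]mxE => gj.
rewrite [g`_j * _]mulrC /u lcomb_row; rewrite -[RHS](mulr0 (bv 0 j)); congr (_ * _).
by rewrite -[RHS]gj; apply: eq_bigr => l _; rewrite !mxE.
Qed.

End Theory.
End Functional.

(** * Standard monomials of the radical *)

(** With t = s m, the larger sum is at least t (t + 1) / 2 and the smaller at most t (t - 1) / 2.
    The case t = 0 is decided by s 0 = 1. *)
Lemma sum_head_gt_tail (s : nat -> nat) m k :
  s 0%N = 1%N -> (forall i, s i.+1 <= (s i).+1)%N ->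
  (forall i, m <= i -> s i.+1 <= (s i).-1)%N ->
  (\sum_(m.+1 <= i < m.+1 + k) s i < \sum_(0 <= i < m.+1) s i)%N.
Proof.
move=> s0 up down.
have head j : (s j * (s j).+1 <= 2 * \sum_(0 <= i < j.+1) s i)%N /\
              (0 < \sum_(0 <= i < j.+1) s i)%N.
  elim: j => [|j [IH1 IH2]]; first by rewrite big_nat1; split => //; nia.
  by rewrite big_nat_recr //=; split; have := up j; nia.
have tail : (2 * \sum_(m.+1 <= i < (m + k).+1) s i + s (m + k) * (s (m + k)).-1
    <= s m * (s m).-1)%N.
  elim: k => [|k IH]; first by rewrite !addn0 big_geq.
  rewrite addnS big_nat_recr /=; last by lia.
  have := down _ (leq_addr k m); move: IH.
  by case: (s (m + k)%N) (s (m + k).+1) => [|x] [|y] /= IH yx; nia.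
have [h1 h2] := head m; rewrite addSn; move: h1 h2 tail.
by case: (s m) => [|x] /= h1 h2 tail; nia.
Qed.

Section StandardMonomials.
Variables (R : realFieldType) (L : {poly {poly R}} -> R).
Hypothesis linL : functional L.
Implicit Types (u v k : {poly {poly R}}) (i b : nat).

(** x^(i - b) y^b is the leading monomial of an element of the radical, for the order by total
    degree and then by the exponent of y. *)
Definition lead_in i b : Prop :=
  exists k, [/\ radical L k, tdeg i k & size (top_form i k) = b.+1].

Definition std_exponents i : seq nat := [seq b <- iota 0 i.+1 | ~~ `[< lead_in i b >]].

Lemma mem_std i b : (b \in std_exponents i) = (b <= i)%N && ~~ `[< lead_in i b >].
Proof. by rewrite mem_filter mem_iota /= ltnS andbC. Qed.

Lemma std_uniq i : uniq (std_exponents i).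
Proof. exact/filter_uniq/iota_uniq. Qed.

Lemma notin_std i b : (b <= i)%N -> b \notin std_exponents i -> lead_in i b.
Proof. by rewrite mem_std => -> /=; rewrite negbK => /asboolP. Qed.

Lemma tdeg_mulx i u : tdeg i u -> tdeg i.+1 (mon R 1 0 * u) /\ top_form i.+1 (mon R 1 0 * u) =
  top_form i u.
Proof.
move=> du; have d1 : tdeg 1 (mon R 1 0) by apply: tdeg_mon.
split; first by rewrite -add1n; apply: tdegM.
by rewrite -add1n topM // (top_mon R 1 0) expr0 mul1r.
Qed.

Lemma tdeg_muly i u : tdeg i u ->
  tdeg i.+1 (mon R 0 1 * u) /\ top_form i.+1 (mon R 0 1 * u) = 'X * top_form i u.
Proof.
move=> du; have d1 : tdeg 1 (mon R 0 1) by apply: tdeg_mon.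
split; first by rewrite -add1n; apply: tdegM.
by rewrite -add1n topM // (top_mon R 0 1) expr1.
Qed.

Lemma lead_inx i b : lead_in i b -> lead_in i.+1 b.
Proof.
move=> [k [rk dk sk]]; have [dx tx] := tdeg_mulx dk.
by exists (mon R 1 0 * k); rewrite tx; split => //; rewrite mulrC; apply: radicalM.
Qed.

Lemma lead_iny i b : lead_in i b -> lead_in i.+1 b.+1.
Proof.
move=> [k [rk dk sk]]; have [dx tx] := tdeg_muly dk.
exists (mon R 0 1 * k); rewrite tx; split => //; first by rewrite mulrC; apply: radicalM.
by rewrite mulrC size_mulX ?sk // -size_poly_gt0 sk.
Qed.

Lemma size_sub_lead (p q : {poly R}) : size p = size q -> q != 0 ->
  (size (p - (lead_coef p / lead_coef q) *: q)%R < size p)%N.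
Proof.
move=> spq q0.
have sp0 : (0 < size p)%N by rewrite spq size_poly_gt0.
rewrite -(prednK sp0) ltnS; apply/leq_sizeP => j; rewrite leq_eqVlt => /orP[/eqP<-|lt].
  rewrite coefB coefZ -[p`__]/(lead_coef p) spq -[q`__]/(lead_coef q).
  by rewrite divfK ?lead_coef_eq0 // subrr.
have pj : (size p <= j)%N by move: lt; rewrite prednK.
by rewrite coefB coefZ !nth_default ?mulr0 ?subr0 // -spq.
Qed.

Lemma cancel_lead i u k : tdeg i u -> tdeg i k -> size (top_form i u) = size (top_form i k) ->
  top_form i k != 0 ->
  exists c, tdeg i (u - c%:P *: k) /\ (size (top_form i (u - c%:P *: k)%R) < size (top_form i u))%N.
Proof.
move=> du dk s0 k0; exists (lead_coef (top_form i u) / lead_coef (top_form i k)).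
split; first by apply: tdegB => //; apply: tdegCZ.
by rewrite topD topN topCZ; apply: size_sub_lead.
Qed.

(** Multiplication by x keeps the exponent of y of a leading monomial, so i + 1 is the only exponent
    that can be new. *)
Lemma std_succ i : (size (std_exponents i.+1) <= (size (std_exponents i)).+1)%N.
Proof.
rewrite -[X in (_ <= X)%N]/(size (i.+1 :: std_exponents i)); apply: uniq_leq_size;
  first exact: std_uniq.
move=> b; rewrite inE !mem_std; have [->//|bi] /= := eqVneq b i.+1.
move=> /andP[bi1 nl]; apply/andP; split; first by lia.
by apply: contra nl => /asboolP ?; apply/asboolP/lead_inx.
Qed.

Section TopForms.
Variables (n m : nat) (h f : {poly {poly R}}).
Hypotheses (nm : (n <= m)%N) (rh : radical L h) (rf : radical L f).
Hypotheses (dh : tdeg n h) (df : tdeg m f) (hn : h`_n`_0 != 0).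
Hypothesis cop : coprimep (top_form n h) (top_form m f).

Lemma size_top_h : size (top_form n h) = n.+1.
Proof.
apply/eqP; rewrite eqn_leq size_top /= ltnNge; apply: contra hn => sz.
have := nth_default 0 sz; rewrite coef_top leqnn subnn => ->; exact: eqxx.
Qed.

Lemma lead_in_h i : (n <= i)%N -> lead_in i i.
Proof.
elim: i => [|i IH].
  rewrite leqn0 => /eqP n0; exists h; move: size_top_h dh; rewrite n0 => s0 d0; split => //.
by rewrite leq_eqVlt => /orP[/eqP<-|/IH/lead_iny//]; exists h; split; rewrite ?size_top_h.
Qed.

Lemma radical_top i j u : (j <= i)%N -> tdeg j u -> radical L u ->
  exists v, [/\ radical L v, tdeg i v & top_form i v = top_form j u].
Proof.
move=> /subnK <-; elim: (i - j)%N => [|k IH] du ru; first by exists u.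
have [v [rv dv tv]] := IH du ru; have [dx tx] := tdeg_mulx dv.
exists (mon R 1 0 * v); rewrite addSn tx; split => //.
by rewrite mulrC; apply: radicalM.
Qed.

(* If no monomial is lost between degrees i and i+1, the leading forms of the
   radical in degree i are the multiples of a single nonconstant form. *)
Lemma std_drop i : (m <= i)%N -> (size (std_exponents i.+1) <= (size (std_exponents i)).-1)%N.
Proof.
move=> mi; have ni := leq_trans nm mi.
have sub : {subset std_exponents i.+1 <= std_exponents i}.
  move=> b; rewrite !mem_std => /andP[]; rewrite leq_eqVlt => /orP[/eqP->|bi nl].
    by move=> /asboolPn[]; apply: lead_in_h; apply: leq_trans ni _.
  rewrite -ltnS bi; apply: contra nl => /asboolP ?; exact/asboolP/lead_inx.
have [//|lt] := leqP (size (std_exponents i.+1)) (size (std_exponents i)).-1; exfalso.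
have lei : (size (std_exponents i) <= size (std_exponents i.+1))%N by lia.
have [_ eqi] := uniq_min_size (std_uniq i.+1) sub lei.
have i0 : (0 < size (std_exponents i.+1))%N by lia.
have inot : i \notin std_exponents i by rewrite mem_std leqnn /= negbK; apply/asboolP/lead_in_h.
(* As nothing is lost, multiplication by y shows that the standard exponents form an initial
   segment, which ends before [c]. *)
have pre b : b.+1 \in std_exponents i -> b \in std_exponents i.
  rewrite -eqi !mem_std ltnS => /andP[-> nl] /=.
  by apply: contra nl => /asboolP ?; apply/asboolP/lead_iny.
have pres b b' : (b' <= b)%N -> b \in std_exponents i -> b' \in std_exponents i.
  move=> /subnK <-; elim: (b - b')%N => // x IH; rewrite addSn => /pre; exact: IH.
have exc : exists c, c \notin std_exponents i by exists i.
pose c := ex_minn exc.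
have [cnot cmin] : c \notin std_exponents i /\ forall b, b \notin std_exponents i -> (c <= b)%N.
  by rewrite /c; case: ex_minnP.
have ci : (c <= i)%N by apply: cmin.
have c0 : (0 < c)%N.
  rewrite lt0n; apply: contra cnot => /eqP->.
  case E : (std_exponents i.+1) i0 => [//|b r] _.
  by apply: (pres b) => //; apply: sub; rewrite E inE eqxx.
have red b : lead_in i b -> (b <= i)%N -> (c <= b)%N.
  by move=> lb bi; apply: cmin; rewrite mem_std bi /= negbK; apply/asboolP.
have red1 b : lead_in i.+1 b -> (b <= i)%N -> lead_in i b.
  move=> lb bi; apply: notin_std => //; rewrite -eqi mem_std negb_and negbK.
  by apply/orP; right; apply/asboolP.
have stdlead u : radical L u -> tdeg i u -> top_form i u != 0 -> lead_in i (size (top_form i u)).-1.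
  by move=> ru du u0; exists u; split => //; rewrite prednK // size_poly_gt0.
(* The size bound says that the leading form in degree i + 1 is divisible by x; its quotient by x is
   then a leading form in degree i. *)
have lower u : radical L u -> tdeg i.+1 u -> (size (top_form i.+1 u) <= i.+1)%N ->
    exists v, [/\ radical L v, tdeg i v & top_form i v = top_form i.+1 u].
  have [k] := ubnP (size (top_form i.+1 u)); elim: k u => // k IH u uk ru du su.
  have [u0|u0] := eqVneq (top_form i.+1 u) 0.
    exists 0; split; [exact: radical0|exact: tdeg0|].
    by rewrite u0; apply/polyP => b; rewrite coef_top !coef0 if_same.
  have sz : (0 < size (top_form i.+1 u))%N by rewrite size_poly_gt0.
  have [||w [rw dw sw]] := red1 (size (top_form i.+1 u)).-1.
  - by exists u; rewrite prednK.
  - by move: su; case: (size _).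
  rewrite prednK // in sw; have [dx tx] := tdeg_mulx dw.
  have [||a [da sa]] := cancel_lead du dx; first by rewrite tx.
    by rewrite tx -size_poly_gt0 sw.
  have [||||v [rv dv tv]] := IH (u - a%:P *: (mon R 1 0 * w)).
  - by apply: leq_trans sa _.
  - by apply: radicalB => //; apply: radicalCZ => //; rewrite mulrC; apply: radicalM.
  - by [].
  - by apply: leq_trans (ltnW sa) su.
  exists (v + a%:P *: w); split.
  - by apply: radicalD => //; apply: radicalCZ.
  - by apply: tdegD => //; apply: tdegCZ.
  by rewrite topD tv topD topN !topCZ tx subrK.
have [w [rw dw sw]] := notin_std ci cnot.
pose g := top_form i w.
have g0 : g != 0 by rewrite -size_poly_gt0 /g sw.
(* Multiply by y, then divide by x with [lower]: the degree stays at i. *)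
have mulg j : (c + j <= i)%N -> exists v, [/\ radical L v, tdeg i v & top_form i v = 'X^j * g].
  elim: j => [|j IH] cj; first by exists w; rewrite mul1r.
  have [|v [rv dv tv]] := IH; first by lia.
  have [dy ty] := tdeg_muly dv.
  have [|||v' [rv' dv' tv']] := lower (mon R 0 1 * v) => //.
  - by rewrite mulrC; apply: radicalM.
  - rewrite ty tv mulrA -exprS mulrC size_mulXn // /g sw; lia.
  by exists v'; rewrite tv' ty tv mulrA -exprS.
(* All leading exponents in degree i are at least [c], so multiples of [g] cancel the leading form
   down to 0. *)
have dvdg u : radical L u -> tdeg i u -> g %| top_form i u.
  have [k] := ubnP (size (top_form i u)); elim: k u => // k IH u uk ru du.
  have [->|u0] := eqVneq (top_form i u) 0; first exact: dvdp0.
  have sz : (0 < size (top_form i u))%N by rewrite size_poly_gt0.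
  have su := size_top i u.
  have cb := red _ (stdlead _ ru du u0) ltac:(lia).
  have [|v [rv dv tv]] := mulg ((size (top_form i u)).-1 - c)%N; first by lia.
  have sv : size (top_form i u) = size (top_form i v).
    by rewrite tv mulrC size_mulXn // /g sw; lia.
  have [|a [da sa]] := cancel_lead du dv sv; first by rewrite -size_poly_gt0 -sv.
  have : g %| top_form i (u - a%:P *: v).
    apply: IH => //; first by apply: leq_trans sa _.
    by apply: radicalB => //; apply: radicalCZ.
  rewrite topD topN topCZ tv dvdp_addl // dvdpNr dvdpZr ?dvdp_mull //.
  apply: contraTneq sa => ->; by rewrite scale0r subr0 ltnn.
have [v [rv dv tv]] := radical_top ni dh rh.
have [v' [rv' dv' tv']] := radical_top mi df rf.
have := coprimepP _ _ cop g; rewrite -tv -tv' => /(_ (dvdg _ rv dv) (dvdg _ rv' dv')).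
by rewrite -size_poly_eq1 /g sw eqSS; move: c0; case: (c).
Qed.

Definition mon_pair (p : nat * nat) := mon R p.1 p.2.

Definition std_pairs (r : seq nat) : seq (nat * nat) :=
  [seq ((i - b)%N, b) | i <- r, b <- std_exponents i].

Lemma size_std_pairs a l :
  size (std_pairs (iota a l)) = (\sum_(a <= i < a + l) size (std_exponents i))%N.
Proof.
rewrite size_allpairs_dep sumnE big_map /index_iota addKn; apply: eq_bigr => i _ //.
Qed.

Lemma mem_std_pairs r a b :
  ((a, b) \in std_pairs r) = ((a + b)%N \in r) && (b \in std_exponents (a + b)).
Proof.
apply/allpairsPdep/andP => [[i [c [ir ic [-> ->]]]]|[H1 H2]].
  have ci : (c <= i)%N by move: ic; rewrite mem_std => /andP[].
  by rewrite subnK.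
by exists (a + b)%N, b; rewrite addnK.
Qed.

Lemma std_pairs_uniq r : uniq r -> uniq (std_pairs r).
Proof.
move=> ur; apply: allpairs_uniq_dep => //; first by move=> i _; apply: std_uniq.
move=> [i b] [j c] /allpairsPdep[i' [b' [_ ib [-> ->]]]] /allpairsPdep[j' [c' [_ jc [-> ->]]]] /=.
move: ib jc; rewrite !mem_std => /andP[ib _] /andP[jc _] [e1 e2].
by move: ib jc e1; rewrite -e2 => ib jc e1; congr existT; lia.
Qed.

Lemma lcomb_monp_coef (s : seq (nat * nat)) (c : 'rV_(size (map mon_pair s))) a b :
  (lcomb c)`_b`_a = \sum_(j < size (map mon_pair s)) c 0 j * (nth (0, 0)%N s j == (a, b))%:R.
Proof.
rewrite coef_sum coef_sum; apply: eq_bigr => j _.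
have js : (j < size s)%N by rewrite -(size_map mon_pair).
by rewrite coefCZ (nth_map (0, 0)%N) // coef_mon -pair_eqE /= eq_sym [b == _]eq_sym.
Qed.

Lemma lcomb_monp_inj (s : seq (nat * nat)) (c : 'rV_(size (map mon_pair s))) :
  uniq s -> lcomb c = 0 -> c = 0.
Proof.
move=> us u0; apply/rowP => j; rewrite mxE.
have js : (j < size s)%N by rewrite -(size_map mon_pair).
have := congr1 (fun w : {poly {poly R}} => w`_(nth (0, 0)%N s j).2`_(nth (0, 0)%N s j).1) u0.
rewrite lcomb_monp_coef !coef0 (bigD1 j) //= -surjective_pairing eqxx mulr1 big1 ?addr0 //.
move=> l lj; have ls : (l < size s)%N by rewrite -(size_map mon_pair).
by rewrite nth_uniq // val_eqE (negbTE lj) mulr0.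
Qed.

(** The leading monomial of a nonzero combination is one of the standard monomials, so the
    combination cannot lie in the radical. *)
Lemma std_indep r (c : 'rV_(size (map mon_pair (std_pairs r)))) : uniq r ->
  radical L (lcomb c) -> c = 0.
Proof.
move=> ur; set s := std_pairs r in c *; set u := lcomb c => ru.
have us : uniq s by apply: std_pairs_uniq.
have u0 : u = 0.
  apply/eqP/negP => /negP /exact_tdeg[i [du tu]].
  pose b := (size (top_form i u)).-1.
  have lb : lead_in i b by exists u; rewrite prednK // size_poly_gt0.
  have bi : (b <= i)%N by have := size_top i u; rewrite /b; lia.
  have : lead_coef (top_form i u) != 0 by rewrite lead_coef_eq0.
  rewrite /lead_coef -/b coef_top bi lcomb_monp_coef -/s => /eqP[].
  rewrite big1 // => j _; case: eqP => [ej|]; last by rewrite mulr0.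
  have : nth (0, 0)%N s j \in s by apply: mem_nth; rewrite -(size_map mon_pair).
  by rewrite ej mem_std_pairs subnK // mem_std => /and3P[_ _ /asboolPn[]].
exact: lcomb_monp_inj us u0.
Qed.

(** Division by leading forms: a leading monomial is standard or leads an element of the radical,
    and can be cancelled in both cases. The degree m separates the two lists because positivity is
    known only up to m. *)
Lemma std_spans N u : (forall i, (N <= i)%N -> std_exponents i = [::]) -> (m.+1 <= N)%N ->
  exists (a : 'rV_(size (map mon_pair (std_pairs (iota 0 m.+1)))))
         (b : 'rV_(size (map mon_pair (std_pairs (iota m.+1 (N - m.+1)))))),
    radical L (u - (lcomb a + lcomb b)).
Proof.
move=> k0 mk; set e := map mon_pair _; set g := map mon_pair _.
pose G u := exists (a : 'rV_(size e)) (b : 'rV_(size g)), radical L (u - (lcomb a + lcomb b)).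
have l0 s : lcomb (0 : 'rV_(size s)) = 0 :> {poly {poly R}}.
  by rewrite /lcomb big1 // => j _; rewrite mxE scale0r.
have G0 v : radical L v -> G v by move=> rv; exists 0, 0; rewrite !l0 addr0 subr0.
have GD c v w : G v -> G w -> G (c%:P *: v + w).
  move=> [a [b ab]] [a' [b' ab']]; exists (c *: a + a'), (c *: b + b'); rewrite !lcombP.
  have -> : c%:P *: v + w - (c%:P *: lcomb a + lcomb a' + (c%:P *: lcomb b + lcomb b')) =
     c%:P *: (v - (lcomb a + lcomb b)) + (w - (lcomb a' + lcomb b')).
    by rewrite -!mul_polyC; ring.
  by apply: radicalD => //; apply: radicalCZ.
have ldelta (s : seq {poly {poly R}}) l : l \in s -> exists c : 'rV_(size s), lcomb c = l.
  move=> ls; have il : (index l s < size s)%N by rewrite index_mem.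
  exists (delta_mx 0 (Ordinal il)); rewrite /lcomb (bigD1 (Ordinal il)) //= big1 ?addr0.
    by rewrite mxE !eqxx scale1r nth_index.
  by move=> j jl; rewrite mxE eqxx (negbTE jl) scale0r.
have Gstd i b : b \in std_exponents i -> G (mon R (i - b) b).
  move=> bi; have bi' : (b <= i)%N by move: bi; rewrite mem_std => /andP[].
  have ik : (i < N)%N by rewrite ltnNge; apply/negP => /k0 E; rewrite E in bi.
  have [im|im] := leqP i m.
    have [|c cE] := ldelta e (mon R (i - b) b).
      apply/(map_f mon_pair (x := (_, _))); rewrite mem_std_pairs subnK // bi mem_iota; lia.
    by exists c, 0; rewrite l0 addr0 cE subrr; apply: radical0.
  have [|c cE] := ldelta g (mon R (i - b) b).
    apply/(map_f mon_pair (x := (_, _))); rewrite mem_std_pairs subnK // bi mem_iota; lia.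
  by exists 0, c; rewrite l0 add0r cE subrr; apply: radical0.
have red v w c : G w -> G (v - c%:P *: w) -> G v.
  by move=> Gw Gv; rewrite -(subrK (c%:P *: w) v) addrC; apply: GD.
have step i : (forall v, tdeg i v -> top_form i v = 0 -> G v) -> forall v, tdeg i v -> G v.
  move=> Gtop v; have [l] := ubnP (size (top_form i v)); elim: l v => // l IH v vl dv.
  have [v0|v0] := eqVneq (top_form i v) 0; first exact: Gtop.
  have sz : (0 < size (top_form i v))%N by rewrite size_poly_gt0.
  pose b := (size (top_form i v)).-1.
  have bi : (b <= i)%N by have := size_top i v; rewrite /b; lia.
  have [w [Gw dw sw]] : exists w, [/\ G w, tdeg i w & size (top_form i w) = size (top_form i v)].
    have [bs|/(notin_std bi)[w [rw dw sw]]] := boolP (b \in std_exponents i).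
      exists (mon R (i - b) b); split; [exact: Gstd|by apply: tdeg_mon; lia|].
      by rewrite -{1}(subnK bi) top_mon size_polyXn /b prednK.
    by exists w; split => //; [apply: G0|rewrite sw prednK].
  have [|c [dc sc]] := cancel_lead dv dw (esym sw); first by rewrite -size_poly_gt0 sw.
  by apply: (red v w c Gw); apply: IH => //; apply: leq_trans sc _.
suff main i : forall v, tdeg i v -> G v by have [d dd] := tdeg_exists u; apply: main dd.
elim: i => [|i IHi]; apply: step => v dv v0; last exact/IHi/tdeg_top0.
by apply: G0; rewrite (tdeg0_top0 dv v0); apply: radical0.
Qed.

(** Otherwise the standard monomials of degree at most m, on whose span [L] is nonnegative on
    squares, outnumber the others, against [psd_half_rank]. *)
Lemma psd_radical1 I : radical L (I ^+ 2 + 1) ->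
  (forall u, tdeg m u -> 0 <= L (u ^+ 2)) -> radical L 1.
Proof.
move=> rI psd; have [//|nr1] := EM (radical L 1); exfalso.
have s0 : size (std_exponents 0) = 1%N.
  rewrite /std_exponents /=; case: asboolP => // -[k [rk dk sk]]; case: nr1.
  have kE : k = (k`_0`_0)%:P *: 1.
    by have := mon_expand dk; rewrite !big_ord1 mon00.
  have k0 : k`_0`_0 != 0.
    apply/eqP => k0; move: kE sk; rewrite k0 scale0r => ->.
    have -> : top_form 0 (0 : {poly {poly R}}) = 0.
      by apply/polyP => b; rewrite coef_top !coef0 if_same.
    by rewrite size_poly0.
  have -> : 1 = ((k`_0`_0)^-1)%:P *: k by rewrite {2}kE scalerA -polyCM mulVf // scale1r.
  exact: radicalCZ.
pose s i := size (std_exponents i).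
have zero j : (s (m + j) <= s m - j)%N.
  elim: j => [|j IH]; first by rewrite addn0 subn0.
  rewrite addnS; have := std_drop (leq_addr j m); rewrite -/(s _) -/(s _); lia.
(* From degree m on the count falls to 0 within [s m] steps; the added 1 puts [k] above m. *)
pose k := (m.+1 + s m)%N.
have std0 i : (k <= i)%N -> std_exponents i = [::].
  move=> ki; apply: size0nil; have := zero (i - m)%N; rewrite subnKC; last by lia.
  rewrite -[size _]/(s i); move: ki; rewrite /k; lia.
have mk : (m.+1 <= k)%N by lia.
pose e := map mon_pair (std_pairs (iota 0 m.+1)).
pose g := map mon_pair (std_pairs (iota m.+1 (k - m.+1))).
have : (size e <= size g)%N.
  apply: (psd_half_rank linL rI).
  - move=> c; apply: psd; apply: tdeg_sum => j _; apply: tdegCZ.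
    have : e`_j \in e by apply: mem_nth.
    move=> /mapP[[a b]]; rewrite mem_std_pairs mem_iota => /andP[ab _] ->.
    by apply: tdeg_mon => /=; lia.
  - by move=> c; apply: std_indep; apply: iota_uniq.
  - by move=> u; apply: std_spans.
rewrite !size_map !size_std_pairs leqNgt => /negP[]; apply: sum_head_gt_tail => //.
- exact: std_succ.
- exact: std_drop.
Qed.

End TopForms.
End StandardMonomials.

(** * Extension to a complete intersection *)

Section CompleteIntersection.
Variables (R : rcfType) (n m : nat) (h f : {poly {poly R}}).
Hypotheses (dh : tdeg n h) (df : tdeg m f) (hn : h`_n`_0 != 0).
Hypothesis cop : coprimep (top_form n h) (top_form m f).
Implicit Types (u v a b : {poly {poly R}}).

Let sh : size (top_form n h) = n.+1 := size_top_h hn.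

Let h0 : top_form n h != 0.
Proof. by rewrite -size_poly_gt0 sh. Qed.

(** Coprime binary forms of degrees n and m generate all forms of degree at least n + m - 1. Taking
    the second cofactor modulo [top_form n h] bounds both degrees. *)
Lemma tops_generate (w : {poly R}) N : (size w <= N.+1)%N -> (n + m <= N.+1)%N ->
  exists a b : {poly R}, [/\ (size a <= (N - n).+1)%N, (size b <= (N - m).+1)%N &
    w = a * top_form n h + b * top_form m f].
Proof.
move=> sw nmN; have /Bezout_eq1_coprimepP[[s t] /= st] := cop.
pose b : {poly R} := (w * t) %% top_form n h.
have sb : (size b <= n)%N by rewrite -ltnS -sh ltn_modp.
have sf := size_top m f.
have sbf : (size (b * top_form m f)%R <= N.+1)%N.
  have [->|b0] := eqVneq b 0; first by rewrite mul0r size_poly0.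
  apply: leq_trans (size_polyMleq _ _) _; move: sb sf.
  by move: (size b) (size (top_form m f)) => x y; lia.
have /dvdpP[a aE] : top_form n h %| w - b * top_form m f.
  have -> : w - b * top_form m f = w * s * top_form n h + (w * t - b) * top_form m f.
    by rewrite -{1}[w]mulr1 -st; ring.
  apply: dvdp_add; first exact: dvdp_mull.
  by apply: dvdp_mulr; rewrite /b {1}(divp_eq (w * t) (top_form n h)) addrK dvdp_mull.
exists a, b; split; last by rewrite -aE subrK.
  have [->|a0] := eqVneq a 0; first by rewrite size_poly0.
  have : (size (a * top_form n h)%R <= N.+1)%N.
    rewrite -aE; apply: leq_trans (size_polyD _ _) _.
    by rewrite geq_max sw size_polyN.
  rewrite size_mul // sh addnS /=; move: a0; rewrite -size_poly_gt0.
  by move: (size a) => x; lia.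
by move: sb; move: (size b) => x; lia.
Qed.

Lemma ideal2D u v : ideal2 h f u -> ideal2 h f v -> ideal2 h f (u + v).
Proof. by move=> [a [b ->]] [a' [b' ->]]; exists (a + a'), (b + b'); ring. Qed.

Lemma ideal2CZ c u : ideal2 h f u -> ideal2 h f (c%:P *: u).
Proof.
by move=> [a [b ->]]; exists (c%:P *: a), (c%:P *: b); rewrite scalerDr !scalerAl.
Qed.

(** In each degree above N the leading form is cancelled by a combination of [h] and [f]. *)
Lemma reduce_degree N u : (n <= N)%N -> (m <= N)%N -> (n + m <= N.+2)%N ->
  exists v, tdeg N v /\ ideal2 h f (u - v).
Proof.
move=> nN mN nmN; suff H M v : tdeg (N + M) v -> exists w, tdeg N w /\ ideal2 h f (v - w).
  have [M dM] := tdeg_exists u; apply: (H M); apply: tdegW dM; exact: leq_addl.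
elim: M v => [|M IH] v.
  by rewrite addn0 => dv; exists v; split=> //; exists 0, 0; rewrite subrr !mul0r addr0.
rewrite addnS => dv; set N' := (N + M).+1 in dv.
have [||a [b [sa sb e]]] := tops_generate (w := top_form N' v) (N := N').
- exact: size_top.
- by rewrite /N'; lia.
have en : ((N' - n) + n = N')%N by rewrite subnK // /N'; lia.
have em : ((N' - m) + m = N')%N by rewrite subnK // /N'; lia.
have da : tdeg (N' - n) (form_lift (N' - n) a) by apply: tdeg_hom.
have db : tdeg (N' - m) (form_lift (N' - m) b) by apply: tdeg_hom.
have [w [dw [a' [b' e']]]] : exists w, tdeg N w /\
    ideal2 h f (v - (form_lift (N' - n) a * h + form_lift (N' - m) b * f) - w).
  apply: IH; apply: tdeg_top0; rewrite -/N'.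
    apply: tdegB => //; apply: tdegD.
      by have := tdegM da dh; rewrite en.
    by have := tdegM db df; rewrite em.
  have := topM da dh; have := topM db df; rewrite en em !top_hom // => tb ta.
  by rewrite topD topN topD e ta tb subrr.
exists w; split => //; exists (a' + form_lift (N' - n) a), (b' + form_lift (N' - m) b).
have -> : v - w = v - (form_lift (N' - n) a * h + form_lift (N' - m) b * f) - w +
  (form_lift (N' - n) a * h + form_lift (N' - m) b * f) by ring.
by rewrite e'; ring.
Qed.

(** Leading forms of cofactors of excessive degree are a syzygy of two coprime forms, hence a
    multiple [q] of the trivial one. Subtracting a lift of it lowers the degree. *)
Lemma bounded_cofactors i u : (n <= i)%N -> (m <= i)%N -> tdeg i u -> ideal2 h f u ->
  exists a b, [/\ tdeg (i - n) a, tdeg (i - m) b & u = a * h + b * f].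
Proof.
move=> ni mi du [a0 [b0 e0]].
suff H k a b : tdeg (i + k - n) a -> tdeg (i + k - m) b -> u = a * h + b * f ->
    exists a b, [/\ tdeg (i - n) a, tdeg (i - m) b & u = a * h + b * f].
  have [ka dka] := tdeg_exists a0; have [kb dkb] := tdeg_exists b0.
  apply: (H (ka + kb)%N) e0; [apply: tdegW dka|apply: tdegW dkb]; lia.
elim: k a b => [|k IH] a b; first by rewrite addn0; exists a, b.
rewrite addnS => da db e; set N := (i + k).+1 in da db.
have en : ((N - n) + n = N)%N by rewrite subnK // /N; lia.
have em : ((N - m) + m = N)%N by rewrite subnK // /N; lia.
have sn : (N - n = (i + k - n).+1)%N by rewrite /N; lia.
have sm : (N - m = (i + k - m).+1)%N by rewrite /N; lia.
have t0 : top_form (N - n) a * top_form n h + top_form (N - m) b * top_form m f = 0.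
  have := topM da dh; have := topM db df; rewrite en em => <- <-; rewrite -topD -e;
    apply: top_lt du _; rewrite /N; lia.
have /dvdpP[q qE] : top_form n h %| top_form (N - m) b.
  rewrite -(Gauss_dvdpl _ cop); apply/dvdpP; exists (- top_form (N - n) a).
  by rewrite mulNr; apply/eqP; rewrite -addr_eq0 addrC t0.
have aE : top_form (N - n) a = - (q * top_form m f).
  apply: (mulIf h0); move/eqP: t0; rewrite addr_eq0 => /eqP ->.
  by rewrite qE mulNr mulrAC.
(* Only a nonzero [q] forces n <= N - m, without which [N - m - n] would be truncated. *)
have [q0|q0] := eqVneq q 0.
  apply: (IH a b) => //; apply: tdeg_top0; rewrite -?sn -?sm //.
    by rewrite aE q0 mul0r oppr0.
  by rewrite qE q0 mul0r.
have sq : (size q + n <= (N - m).+1)%N.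
  by have := size_top (N - m) b; rewrite qE size_mul // sh addnS.
have sq0 : (0 < size q)%N by rewrite size_poly_gt0.
have {sq sq0}lq : (n <= N - m)%N /\ (size q <= (N - m - n).+1)%N.
  by move: sq sq0; move: (size q) => x; lia.
pose w := form_lift (N - m - n) q.
have dw : tdeg (N - m - n) w by exact: tdeg_hom.
have tw : top_form (N - m - n) w = q by rewrite top_hom //; case: lq.
have e1 : (N - m - n + m = N - n)%N by lia.
have e2 : (N - m - n + n = N - m)%N by lia.
apply: (IH (a + w * f) (b - w * h)).
- apply: tdeg_top0; rewrite -sn.
    by apply: tdegD => //; have := tdegM dw df; rewrite e1.
  by have := topM dw df; rewrite topD e1 tw aE => ->; rewrite addNr.
- apply: tdeg_top0; rewrite -sm.
    by apply: tdegB => //; have := tdegM dw dh; rewrite e2.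
  by have := topM dw dh; rewrite topD topN e2 tw qE => ->; rewrite subrr.
- by rewrite e; ring.
Qed.

Lemma vanish_coprime_tops (L : {poly {poly R}} -> R) (r : {poly R}) : functional L ->
  (n <= m)%N ->
  (forall x y, eval2 h x y != 0) ->
  r != 0 -> ideal2 h f r%:P ->
  (forall u, tdeg (2 * m - n) u -> L (h * u) = 0) ->
  (forall u, tdeg m u -> L (f * u) = 0) ->
  (forall u, tdeg m u -> 0 <= L (u ^+ 2)) ->
  forall u, tdeg (2 * m) u -> L u = 0.
Proof.
move=> linL nm hxy r0 ir Lh Lf psd.
have red u : exists v, tdeg (2 * m) v /\ ideal2 h f (u - v) by apply: reduce_degree; lia.
have [rho rhoP] := choice red.
have Lideal v : tdeg (2 * m) v -> ideal2 h f v -> L v = 0.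
  move=> dv iv; have [||a [b [da db ->]]] := bounded_cofactors _ _ dv iv; try lia.
  rewrite (functionalD linL) mulrC Lh // [b * f]mulrC Lf ?addr0 //.
  by move: db; have -> : (2 * m - m = m)%N by lia.
(* The chosen [rho] need not be linear, but [L'] is: two reductions differ by an element of the
   ideal of degree at most 2m, which [L] kills. *)
pose L' u := L (rho u).
have L'E u v : tdeg (2 * m) v -> ideal2 h f (u - v) -> L' u = L v.
  move=> dv iv; apply/eqP; rewrite -subr_eq0 -(functionalB linL); apply/eqP/Lideal.
    by apply: tdegB => //; case: (rhoP u).
  have -> : rho u - v = (u - v) + (-1)%:P *: (u - rho u).
    by rewrite polyCN scaleN1r; ring.
  by apply: ideal2D => //; apply: ideal2CZ; case: (rhoP u).
have i0 : ideal2 h f 0 by exists 0, 0; rewrite !mul0r addr0.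
have L'L v : tdeg (2 * m) v -> L' v = L v by move=> dv; apply: L'E => //; rewrite subrr.
have linL' : functional L'.
  move=> c u v; have [du iu] := rhoP u; have [dv iv] := rhoP v.
  rewrite (L'E _ (c%:P *: rho u + rho v)) ?linL //.
    by apply: tdegD => //; apply: tdegCZ.
  have -> : c%:P *: u + v - (c%:P *: rho u + rho v) = c%:P *: (u - rho u) + (v - rho v).
    by rewrite scalerBr; ring.
  by apply: ideal2D => //; apply: ideal2CZ.
have rad u : ideal2 h f u -> radical L' u.
  move=> [a [b e]] v; rewrite (L'E _ 0) ?(functional0 linL) //; first exact: tdeg0.
  by exists (a * v), (b * v); rewrite e; ring.
have rh : radical L' h by apply: rad; exists 1, 0; ring.
have rf : radical L' f by apply: rad; exists 0, 1; ring.
have [I [a [b e]]] := sqrtN1_curve hxy r0.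
have rI : radical L' (I ^+ 2 + 1).
  apply: rad; have [a' [b' e']] := ir; exists (a + b * a'), (b * b').
  by rewrite e e'; ring.
have rad1 : radical L' 1.
  apply: (psd_radical1 linL' nm rh rf dh df hn cop rI) => u du.
  rewrite L'L; first exact: psd.
  by rewrite mul2n -addnn expr2; apply: tdegM.
by move=> u du; rewrite -L'L // -[u]mul1r; apply: rad1.
Qed.

End CompleteIntersection.

(** * Homogenization *)

Section Homogenization.
Variables (R : idomainType) (A : comNzRingType) (iota : {rmorphism R -> A}).
Implicit Types (u v : {poly {poly R}}) (x y z : A).

(* The value at (x, y, z) of the homogenization of u in degree k. *)
Definition homog x y z k u : A :=
  \sum_(s : 'I_k.+1 * 'I_k.+1 | (s.1 + s.2 <= k)%N)
    iota u`_s.2`_s.1 * (x ^+ s.1 * y ^+ s.2 * z ^+ (k - s.1 - s.2)).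

Lemma homog_linear x y z k c u v :
  homog x y z k (c%:P *: u + v) = iota c * homog x y z k u + homog x y z k v.
Proof.
rewrite mulr_sumr -big_split; apply: eq_bigr => s _ /=.
by rewrite !coefD coefCZ rmorphD rmorphM; ring.
Qed.

Lemma homog0 x y z k : homog x y z k 0 = 0.
Proof. by rewrite /homog big1 // => s _; rewrite !coef0 rmorph0 mul0r. Qed.

Lemma homog_sum x y z k (J : Type) (r : seq J) (Q : pred J) (c : J -> R)
    (F : J -> {poly {poly R}}) :
  homog x y z k (\sum_(j <- r | Q j) (c j)%:P *: F j) =
  \sum_(j <- r | Q j) iota (c j) * homog x y z k (F j).
Proof.
elim: r => [|j r IH]; first by rewrite !big_nil homog0.
by rewrite !big_cons; case: ifP => // _; rewrite homog_linear IH.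
Qed.

Lemma homog_mon x y z k a b : (a + b <= k)%N ->
  homog x y z k (mon R a b) = x ^+ a * y ^+ b * z ^+ (k - a - b).
Proof.
move=> abk; have ak : (a < k.+1)%N by lia. have bk : (b < k.+1)%N by lia.
rewrite /homog (bigD1 (Ordinal ak, Ordinal bk)) //= coef_mon !eqxx rmorph1 mul1r.
rewrite big1 ?addr0 // => -[i j] /= /andP[_ ij]; rewrite coef_mon.
case: eqP => [ia|]; last by rewrite rmorph0 mul0r.
case: eqP => [jb|]; last by rewrite rmorph0 mul0r.
by case/eqP: ij; congr pair; apply: val_inj.
Qed.

Lemma mon_expand_pairs k u : tdeg k u ->
  u = \sum_(s : 'I_k.+1 * 'I_k.+1 | (s.1 + s.2 <= k)%N) (u`_s.2`_s.1)%:P *: mon R s.1 s.2.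
Proof.
move=> du; rewrite [LHS](mon_expand du) exchange_big pair_big big_mkcond [RHS]big_mkcond.
apply: eq_bigr => -[a b] _ /=; case: leqP => // ab.
by rewrite du // scale0r.
Qed.

Lemma homogM x y z i j u v : tdeg i u -> tdeg j v ->
  homog x y z (i + j) (u * v) = homog x y z i u * homog x y z j v.
Proof.
move=> du dv; rewrite {1}(mon_expand_pairs du) {1}(mon_expand_pairs dv) mulr_suml.
under eq_bigr => s _.
  rewrite mulr_sumr.
  under eq_bigr => t _ do rewrite -scalerAl -scalerAr monM scalerA -polyCM.
  over.
rewrite pair_big homog_sum /= mulr_suml.
under [RHS]eq_bigr => s _ do rewrite mulr_sumr.
rewrite pair_big; apply: eq_bigr => -[[a b] [a' b']] /= /andP[ab ab'].
rewrite homog_mon; last by lia.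
have -> : (i + j - (a + a') - (b + b') = (i - a - b) + (j - a' - b'))%N by lia.
by rewrite rmorphM !exprD; ring.
Qed.

Lemma homogX x y z k l u : tdeg k u ->
  homog x y z (l * k) (u ^+ l) = homog x y z k u ^+ l /\ tdeg (l * k) (u ^+ l).
Proof.
move=> du; elim: l => [|l [IH dl]].
  by rewrite !expr0 -(mon00 R) homog_mon // !expr0 !mulr1; split; last exact: tdeg_mon.
by rewrite mulSn !exprS homogM // IH; split => //; apply: tdegM.
Qed.

End Homogenization.

(** Letting [homog] take values in any commutative ring makes evaluations, leading forms, changes of
    chart and the passage to [mpoly] instances of one sum; this naturality relates them. *)
Lemma rmorph_homog (R : idomainType) (A B : comNzRingType) (iota : {rmorphism R -> A})
    (f : {rmorphism A -> B}) x y z k (u : {poly {poly R}}) :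
  f (homog iota x y z k u) = homog (f \o iota) (f x) (f y) (f z) k u.
Proof.
rewrite /homog rmorph_sum; apply: eq_bigr => s _.
by rewrite !rmorphM !rmorphXn.
Qed.

(** * Linear substitutions in forms *)

Section Substitution.
Variables (R : idomainType).
Implicit Types (u v X Y Z : {poly {poly R}}).

Definition subst_form X Y Z k u : {poly {poly R}} :=
  homog (@polyC {poly R} \o @polyC R) X Y Z k u.

Lemma tdegX i l u : tdeg i u -> tdeg (l * i) (u ^+ l).
Proof. by move=> du; have [] := homogX (@idfun R) 0 0 0 l du. Qed.

Lemma tdeg_subst_form X Y Z k u : tdeg 1 X -> tdeg 1 Y -> tdeg 1 Z ->
  tdeg k (subst_form X Y Z k u).
Proof.
move=> dX dY dZ; apply: tdeg_sum => -[a b] /= ab; rewrite mul_polyC; apply: tdegCZ.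
have := tdegM (tdegM (tdegX (l := a) dX) (tdegX (l := b) dY)) (tdegX (l := k - a - b) dZ).
by rewrite !muln1; have -> : (a + b + (k - a - b) = k)%N by lia.
Qed.

Lemma homog_subst (A : comNzRingType) (iota : {rmorphism R -> A}) x y z X Y Z k u :
  tdeg 1 X -> tdeg 1 Y -> tdeg 1 Z ->
  homog iota x y z k (subst_form X Y Z k u) =
  homog iota (homog iota x y z 1 X) (homog iota x y z 1 Y) (homog iota x y z 1 Z) k u.
Proof.
move=> dX dY dZ.
have -> : subst_form X Y Z k u = \sum_(s : 'I_k.+1 * 'I_k.+1 | (s.1 + s.2 <= k)%N)
    (u`_s.2`_s.1)%:P *: (X ^+ s.1 * Y ^+ s.2 * Z ^+ (k - s.1 - s.2)).
  by apply: eq_bigr => s _; rewrite mul_polyC.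
rewrite homog_sum; apply: eq_bigr => -[a b] /= ab; congr (_ * _).
have [eX dXa] := homogX iota x y z a dX; have [eY dYb] := homogX iota x y z b dY.
have [eZ dZc] := homogX iota x y z (k - a - b) dZ.
have dXY := tdegM dXa dYb.
have := homogM iota x y z dXY dZc.
rewrite (homogM iota x y z dXa dYb) eX eY eZ !muln1 => <-.
by have -> : (a + b + (k - a - b) = k)%N by lia.
Qed.

Lemma subst_form_id k u : tdeg k u -> subst_form 'X%:P 'X 1 k u = u.
Proof.
move=> du; rewrite [RHS](mon_expand_pairs du); apply: eq_bigr => -[a b] _ /=.
by rewrite mul_polyC expr1n mulr1 -polyC_exp mul_polyC.
Qed.

End Substitution.

(** The points (1 : y : 0) parametrize the line at infinity z = 0 outside (0 : 1 : 0). *)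
Lemma homog_infinity (R : idomainType) k (u : {poly {poly R}}) :
  homog (@polyC R) 1 'X 0 k u = top_form k u.
Proof.
rewrite /top_form poly_def /homog.
rewrite (bigID (fun s : 'I_k.+1 * 'I_k.+1 => (s.1 + s.2 == k)%N)) /= [X in _ + X]big1 ?addr0.
  rewrite [RHS](eq_bigr (fun b : 'I_k.+1 =>
     \sum_(a < k.+1 | (a + b == k)%N) u`_b`_a *: 'X^b)); last first.
    move=> b _; have bk := ltn_ord b; have kb : (k - b < k.+1)%N by lia.
    rewrite (bigD1 (Ordinal kb)) /=; last by apply/eqP; lia.
    rewrite big1 ?addr0 //.
    move=> a /andP[/eqP ab /eqP]; case; apply: val_inj => /=; lia.
  rewrite (exchange_big_dep predT) //= pair_big_dep /=; apply: eq_big => [[a b]|[a b]] /=.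
    by case: eqP => [e|]; rewrite ?andbF // (leq_trans (eq_leq e)).
  by move=> /andP[_ /eqP ab]; rewrite -subnDA ab subnn expr0 expr1n mul1r mulr1 mul_polyC.
move=> [a b] /= /andP[ab nab]; rewrite expr0n (_ : (k - a - b == 0)%N = false) ?mulr0 //.
by apply/eqP; lia.
Qed.

Section Values.
Variable R : rcfType.
Implicit Types (u h : {poly {poly R}}).

Definition form_value (x y z : R) k u : R := homog (@idfun R) x y z k u.

Lemma value_affine x y k u : tdeg k u -> form_value x y 1 k u = eval2 u x y.
Proof.
move=> du; rewrite -[in RHS](subst_form_id du) /eval2 -!/(horner_eval _ _) !rmorph_homog /=.
rewrite /form_value /homog; apply: eq_bigr => s _ /=.
by rewrite /horner_eval !hornerC !hornerX hornerC.
Qed.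

Lemma value_pole k u : form_value 0 1 0 k u = u`_k`_0.
Proof.
have k1 : (k < k.+1)%N by [].
rewrite /form_value /homog (bigD1 (ord0, Ordinal k1)) //= big1 ?addr0.
  by rewrite expr0 expr1n subn0 subnn expr0 !mulr1.
move=> [a b] /= /andP[ab nab]; have [a0|a0] := eqVneq (a : nat) 0%N; last first.
  by rewrite [0 ^+ a]expr0n (negbTE a0) !mul0r mulr0.
rewrite [0 ^+ (k - a - b)]expr0n (_ : (k - a - b == 0)%N = false) ?mulr0 //.
apply: contraNF nab => kab; apply/eqP; congr pair; apply: val_inj => //=; lia.
Qed.

Definition rootless n h : Prop :=
  forall x y z, ~ [/\ x = 0, y = 0 & z = 0] -> form_value x y z n h != 0.

End Values.

Section Rootless.
Variable R : rcfType.
Implicit Types (h : {poly {poly R}}).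

(** The point (0 : 1 : 0) is not a zero. Together with [tdeg n h] this gives a constant leading
    coefficient in y, hence division by [h]. *)
Lemma rootless_pole n h : rootless n h -> h`_n`_0 != 0.
Proof. by move=> hr; rewrite -value_pole; apply: hr => -[_ /eqP]; rewrite oner_eq0. Qed.

Lemma rootless_affine n h x y : tdeg n h -> rootless n h -> eval2 h x y != 0.
Proof.
by move=> dh hr; rewrite -(value_affine x y dh); apply: hr => -[_ _ /eqP]; rewrite oner_eq0.
Qed.

End Rootless.

Section Chart.
Variables (R : rcfType) (x0 : R).
Implicit Types (u v h f : {poly {poly R}}).

(* The change of chart (x : y : z) = (z' + x0 x' : y' : x'), which moves the line
   x = x0 z to infinity, and its inverse. *)
Definition chart k u := subst_form (1 + x0%:P *: mon R 1 0) 'X (mon R 1 0) k u.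

Definition unchart k u := subst_form 1 'X (mon R 1 0 - x0%:P%:P) k u.

Let d1 : tdeg 1 (1 : {poly {poly R}}).
Proof. by rewrite -(mon00 R); apply: tdeg_mon. Qed.

Let dx : tdeg 1 (mon R 1 0). Proof. exact: tdeg_mon. Qed.

Let yE : 'X = mon R 0 1. Proof. by rewrite /mon expr0 scale1r. Qed.

Let dy : tdeg 1 ('X : {poly {poly R}}). Proof. by rewrite yE; apply: tdeg_mon. Qed.

Let dP : tdeg 1 (1 + x0%:P *: mon R 1 0).
Proof. by apply: tdegD => //; apply: tdegCZ. Qed.

Let dQ : tdeg 1 (mon R 1 0 - x0%:P%:P).
Proof. by apply: tdegB => //; apply: tdegC. Qed.

Section Linear.
Variables (A : comNzRingType) (iota : {rmorphism R -> A}) (x y z : A).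

Lemma homog1_1 : homog iota x y z 1 1 = z.
Proof. by rewrite -(mon00 R) homog_mon // !expr0 !mul1r expr1. Qed.

Lemma homog1_x : homog iota x y z 1 (mon R 1 0) = x.
Proof. by rewrite homog_mon // expr0 !expr1 expr0 !mulr1. Qed.

Lemma homog1_y : homog iota x y z 1 'X = y.
Proof. by rewrite yE homog_mon // !expr0 expr1 mul1r mulr1. Qed.

Lemma homog_chart k u : homog iota x y z k (chart k u) = homog iota (z + iota x0 * x) y x k u.
Proof.
rewrite homog_subst // homog1_x homog1_y addrC homog_linear homog1_x homog1_1.
by rewrite [z + _]addrC.
Qed.

End Linear.

Lemma tdeg_chart k u : tdeg k (chart k u).
Proof. exact: tdeg_subst_form. Qed.

Lemma tdeg_unchart k u : tdeg k (unchart k u).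
Proof. exact: tdeg_subst_form. Qed.

Lemma unchartM i j u v : tdeg i u -> tdeg j v ->
  unchart (i + j) (u * v) = unchart i u * unchart j v.
Proof. exact: homogM. Qed.

Lemma unchart_linear k c u v : unchart k (c%:P *: u + v) = c%:P *: unchart k u + unchart k v.
Proof. by rewrite /unchart /subst_form homog_linear mul_polyC. Qed.

Lemma chartK k u : tdeg k u -> unchart k (chart k u) = u.
Proof.
move=> du; rewrite [LHS]homog_chart -[RHS](subst_form_id du) /=.
by rewrite mulr1 subrK /mon expr0 alg_polyC expr1.
Qed.

(** The new line at infinity is x = x0 z, so the new leading form is u(x0, y). *)
Lemma top_chart k u : tdeg k u -> top_form k (chart k u) = map_poly (horner_eval x0) u.
Proof.
move=> du; rewrite -homog_infinity homog_chart add0r mulr1.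
rewrite -[in RHS](subst_form_id du) [RHS]rmorph_homog; apply: eq_bigr => s _ /=.
by rewrite rmorph1 map_polyX !map_polyC /= /horner_eval !hornerC hornerX.
Qed.

Lemma rootless_chart n h : rootless n h -> rootless n (chart n h).
Proof.
move=> hr x y z xyz; rewrite /form_value homog_chart; apply: hr => -[e1 e2 e3].
by apply: xyz; split => //; rewrite e3 mulr0 addr0 in e1.
Qed.

End Chart.

(** * Null vectors *)

Section Domination.
Variable R : realFieldType.
Implicit Types (u v w : {poly {poly R}}) (L : {poly {poly R}} -> R).

Lemma functional_sqrD L s t u w : functional L ->
  L ((s%:P *: u + t%:P *: w) ^+ 2) =
  s ^+ 2 * L (u ^+ 2) + 2%:R * s * t * L (u * w) + t ^+ 2 * L (w ^+ 2).
Proof.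
move=> linL.
have -> : (s%:P *: u + t%:P *: w) ^+ 2 = (s ^+ 2)%:P *: u ^+ 2 +
    (2%:R * s * t)%:P *: (u * w) + (t ^+ 2)%:P *: w ^+ 2.
  by rewrite -!mul_polyC !polyC_exp !polyCM [2%:R%:P]rmorph_nat; ring.
by rewrite !(functionalD linL) !(functionalZ linL).
Qed.

Lemma psd_cauchy_schwarz L u w : functional L ->
  (forall s t, 0 <= L ((s%:P *: u + t%:P *: w) ^+ 2)) ->
  L (u * w) ^+ 2 <= L (u ^+ 2) * L (w ^+ 2).
Proof.
move=> linL psd; set b := L (u * w); set a := L (u ^+ 2); set c := L (w ^+ 2).
have q s t : 0 <= s ^+ 2 * a + 2%:R * s * t * b + t ^+ 2 * c.
  by rewrite -functional_sqrD.
have c0 : 0 <= c by have := q 0 1; rewrite expr0n /=; lra.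
have [cz|cp] := eqVneq c 0.
  have b0 : b = 0.
    have a0 : 0 <= a by have := q 1 0; rewrite expr0n /=; lra.
    (* For c = 0 these values give - b^2 (a + 2) >= 0. *)
    by have := q b (- (a + 1)); rewrite cz; nra.
  by rewrite b0 cz expr0n mulr0.
have {}cp : 0 < c by rewrite lt0r cp.
have := q c (- b); nra.
Qed.

(** An explicit substitute for compactness of the unit sphere: the Gram matrix of [L] is invertible,
    so each coordinate is a value of [L] against a dual vector, and Cauchy-Schwarz bounds its square
    by a multiple of L((lcomb c)^2). *)
Lemma psd_dominates L L' m (s : seq {poly {poly R}}) : functional L -> functional L' ->
  (forall u, tdeg m u -> 0 <= L (u ^+ 2)) ->
  (forall i, (i < size s)%N -> tdeg m s`_i) ->
  (forall c : 'rV_(size s), L (lcomb c ^+ 2) = 0 -> c = 0) ->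
  exists2 M, 0 <= M & forall c : 'rV_(size s), L' (lcomb c ^+ 2) <= M * L (lcomb c ^+ 2).
Proof.
move=> linL linL' psd ds pd.
have dcomb (c : 'rV_(size s)) : tdeg m (lcomb c).
  by apply: tdeg_sum => j _; apply/tdegCZ/ds.
pose G : 'M_(size s) := \matrix_(i, j) L (s`_i * s`_j).
have GE (c d : 'rV_(size s)) : L (lcomb c * lcomb d) = (c *m G *m d^T) 0 0.
  rewrite mulr_sumr (functional_sum linL) mxE; apply: eq_bigr => j _.
  rewrite -scalerAr functionalZ // mulrC !mxE; congr (_ * _).
  rewrite mulr_suml (functional_sum linL); apply: eq_bigr => i _.
  by rewrite -scalerAl functionalZ // !mxE.
have Gu : G \in unitmx.
  rewrite -row_free_unit; apply/row_freeP; apply/row_freeP.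
  rewrite -kermx_eq0; apply/eqP/row_matrixP => i; rewrite row0; apply: pd.
  by rewrite expr2 GE -row_mul mulmx_ker row0 mul0mx mxE.
pose w i := lcomb (row i (invmx G)).
have dual (c : 'rV_(size s)) i : L (lcomb c * w i) = c 0 i.
  rewrite mulrC GE -row_mul mulVmx // row1 mxE (bigD1 i) //= big1 ?addr0.
    by rewrite !mxE !eqxx mul1r.
  by move=> j ji; rewrite !mxE eqxx (negbTE ji) mul0r.
pose K i := L (w i ^+ 2).
have cK (c : 'rV_(size s)) i : c 0 i ^+ 2 <= K i * L (lcomb c ^+ 2).
  rewrite -(dual c i) mulrC; apply: psd_cauchy_schwarz => // a b.
  by apply: psd; apply: tdegD; apply/tdegCZ/dcomb.
have K0 i : 0 <= K i by apply/psd/dcomb.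
pose N i j := `|L' (s`_i * s`_j)|.
exists (\sum_(i < size s) \sum_(j < size s) (K i + K j) * N i j).
  apply: sumr_ge0 => i _; apply: sumr_ge0 => j _.
  by rewrite mulr_ge0 ?normr_ge0 ?addr_ge0.
move=> c; set q := L (lcomb c ^+ 2).
have q0 : 0 <= q by apply/psd/dcomb.
rewrite expr2 {1}/lcomb mulr_suml (functional_sum linL') mulr_suml; apply: ler_sum => i _.
rewrite -scalerAl functionalZ // mulr_sumr (functional_sum linL') mulr_sumr mulr_suml.
apply: ler_sum => j _; rewrite -scalerAr functionalZ // /N.
have := cK c i; have := cK c j; rewrite -/q; set x := c 0 i; set y := c 0 j => hy hx.
apply: le_trans (ler_norm _) _; rewrite !normrM.
have xy : `|x| * `|y| <= (K i + K j) * q.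
  have h : 0 <= (`|x| - `|y|) ^+ 2 by rewrite sqr_ge0.
  rewrite -[x ^+ 2]real_normK ?num_real // in hx.
  rewrite -[y ^+ 2]real_normK ?num_real // in hy.
  have n1 := normr_ge0 x; have n2 := normr_ge0 y; nra.
rewrite mulrA [leRHS]mulrAC; apply: ler_wpM2r xy; exact: normr_ge0.
Qed.

End Domination.

(** * Division by a polynomial monic in y up to a constant *)

Section Division.
Variables (R : fieldType) (n : nat) (h : {poly {poly R}}).
Hypotheses (dh : tdeg n h) (hn : h`_n`_0 != 0).

Lemma coef_ydeg : h`_n = (h`_n`_0)%:P.
Proof. by apply/polyP => a; rewrite coefC; case: eqP => [->//|a0]; apply: dh; lia. Qed.

Lemma size_ydeg : size h = n.+1.
Proof.
apply/eqP; rewrite eqn_leq; apply/andP; split.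
  by apply/leq_sizeP => j nj; apply/polyP => a; rewrite coef0; apply: dh; lia.
rewrite ltnNge; apply: contra hn => sz.
by rewrite (nth_default _ sz) coef0.
Qed.

Lemma lead_coef_ydeg : lead_coef h = (h`_n`_0)%:P.
Proof.
rewrite lead_coefE; have -> : (size h).-1 = n by rewrite size_ydeg.
exact: coef_ydeg.
Qed.

Lemma lead_coef_unit : lead_coef h \is a GRing.unit.
Proof. by rewrite lead_coef_ydeg poly_unitE size_polyC hn coefC /= unitfE. Qed.

(** Since the leading coefficient in y is a constant, no division step raises the total degree above
    m. *)
Lemma divide_tdeg m u : (n <= m)%N -> tdeg m u ->
  exists q r, [/\ tdeg (m - n) q, tdeg m r, (size r <= n)%N & u = q * h + r].
Proof.
move=> nm; have [k] := ubnP (size u); elim: k u => // k IH u uk du.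
have [un|un] := leqP (size u) n.
  by exists 0, u; split => //; [exact: tdeg0|rewrite mul0r add0r].
pose b := (size u).-1; have sb : size u = b.+1 by rewrite /b prednK //; apply: leq_ltn_trans un.
have nb : (n <= b)%N by rewrite -ltnS -sb.
pose c := h`_n`_0.
pose q : {poly {poly R}} := c^-1%:P *: (u`_b *: 'X^(b - n)).
have dq : tdeg (m - n) q.
  move=> a j aj; rewrite coefCZ coefZ coefXn; have [jb|_] := eqVneq j (b - n)%N; last first.
    by rewrite mulr0 coef0 mulr0.
  by rewrite mulr1 du ?mulr0 //; lia.
have dqh : tdeg m (q * h) by rewrite -(subnK nm); apply: tdegM.
have lt : (size (u - q * h)%R < size u)%N.
  rewrite sb ltnS; apply/leq_sizeP => j; rewrite leq_eqVlt => /orP[/eqP <-|bj].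
    rewrite coefB /q -!scalerAl !coefZ coefXnM ltnNge leq_subr /=.
    rewrite (_ : (b - (b - n) = n)%N); last by lia.
    by rewrite coef_ydeg -/c mulrCA -polyCM mulVf // mulr1 subrr.
  rewrite coefB /q -!scalerAl !coefZ coefXnM nth_default ?sb //.
  rewrite ltnNge (leq_trans (leq_subr _ _) (ltnW bj)) /= [h`__]nth_default ?mulr0 ?subr0 //.
  by rewrite size_ydeg; lia.
have [||q' [r [dq' dr sr e]]] := IH (u - q * h).
- by apply: leq_trans lt _.
- by apply: tdegB.
exists (q' + q), r; split => //; first exact: tdegD.
by rewrite mulrDl addrAC -e subrK.
Qed.

End Division.

(** Only the values of [L] in degree at most 2m are constrained: [L] stands for a positive
    functional on forms of degree 2m modulo [h]. *)
Definition psd_mod (R : rcfType) n m (h : {poly {poly R}}) (L : {poly {poly R}} -> R) : Prop :=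
  [/\ functional L, forall u, tdeg (2 * m - n) u -> L (h * u) = 0 &
      forall u, tdeg m u -> 0 <= L (u ^+ 2)].

(** * Moving a functional to the boundary of the positive ones *)

Section NullVector.
Variables (R : realType) (n m : nat) (h : {poly {poly R}}).
Hypotheses (n0 : (0 < n)%N) (nm : (n <= m)%N) (dh : tdeg n h) (hn : h`_n`_0 != 0).
Implicit Types (u v w f q : {poly {poly R}}) (L : {poly {poly R}} -> R).

Let ulc := lead_coef_unit dh hn.

(** The direction in which [L] is moved: it kills the multiples of [h], is 1 at 1, which bounds the
    move, and 0 at x^2, which keeps [L] nonzero. *)
Let rem_coef0 u : R := ((u %% h)`_0)`_0.

Lemma functional_rem_coef0 : functional rem_coef0.
Proof.
move=> c u v; rewrite /rem_coef0 Pdiv.IdomainUnit.modpD // Pdiv.IdomainUnit.modpZl //.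
by rewrite !coefD coefCZ.
Qed.

Lemma rem_coef0_mul u : rem_coef0 (h * u) = 0.
Proof. by rewrite /rem_coef0 mulrC modp_mull !coef0. Qed.

Lemma rem_coef0_small u : (size u <= n)%N -> rem_coef0 u = u`_0`_0.
Proof. by move=> un; rewrite /rem_coef0 modp_small // (size_ydeg dh hn). Qed.

Let monomials : seq (nat * nat) :=
  [seq p <- [seq (a, b) | a <- iota 0 m.+1, b <- iota 0 n] | (p.1 + p.2 <= m)%N].

Lemma mem_monomials a b : ((a, b) \in monomials) = (a + b <= m)%N && (b < n)%N.
Proof.
rewrite mem_filter [X in X && _]/=.
apply/andP/andP => -[ab].
  by move=> /allpairsPdep[a' [b' [_ H [_ e]]]]; split => //; move: H; rewrite mem_iota e.
by move=> bn; split => //; apply: allpairs_f; rewrite mem_iota; move: ab => /=; lia.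
Qed.

Lemma monomials_uniq : uniq monomials.
Proof.
by apply: filter_uniq; apply: allpairs_uniq; rewrite ?iota_uniq // => -[? ?] [? ?].
Qed.

Lemma remainder_lcomb u : tdeg m u -> (size u <= n)%N ->
  exists c : 'rV_(size (map (@mon_pair R) monomials)), u = lcomb c.
Proof.
move=> du un; pose s := monomials.
exists (\row_j u`_(nth (0, 0)%N s j).2`_(nth (0, 0)%N s j).1).
apply/polyP => b; apply/polyP => a; rewrite lcomb_monp_coef.
have [abs|nabs] := boolP ((a, b) \in s).
  have js : (index (a, b) s < size (map (@mon_pair R) s))%N by rewrite size_map index_mem.
  rewrite (bigD1 (Ordinal js)) //= mxE /= nth_index // eqxx mulr1 big1 ?addr0 //.
  move=> j jn; rewrite (_ : _ == _ = false) ?mulr0 //.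
  apply: contraNF jn => /eqP e; apply/eqP/val_inj => /=.
  by rewrite -e index_uniq ?monomials_uniq // -(size_map (@mon_pair R)).
rewrite big1; last first.
  move=> j _; rewrite (_ : _ == _ = false) ?mulr0 //.
  apply: contraNF nabs => /eqP <-; apply: mem_nth; by rewrite -(size_map (@mon_pair R)).
move: nabs; rewrite mem_monomials negb_and -ltnNge -leqNgt => /orP[ab|nb]; first exact: du.
by rewrite [u`_b]nth_default ?coef0 //; apply: leq_trans nb.
Qed.

Lemma psd_mod_remainder L q r : psd_mod n m h L -> tdeg (m - n) q -> tdeg m r ->
  L ((q * h + r) ^+ 2) = L (r ^+ 2).
Proof.
move=> [linL Lh _] dq dr;
  have -> : (q * h + r) ^+ 2 = h * (q * (q * h + 2%:R * r)) + r ^+ 2 by ring.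
rewrite functionalD // Lh ?add0r //.
have -> : (2 * m - n = (m - n) + m)%N by lia.
apply: tdegM => //; apply: tdegD; first by rewrite -(subnK nm); apply: tdegM.
by rewrite mulr_natl mulr2n; apply: tdegD.
Qed.

(** Take the largest t for which [L] minus t times [rem_coef0] stays positive. Without a null vector
    outside (h), it would be positive definite on remainders, hence dominate [rem_coef0] and allow a
    larger t. *)
Lemma exists_null_vector L : psd_mod n m h L -> (exists2 u, tdeg (2 * m) u & L u != 0) ->
  exists L1, [/\ psd_mod n m h L1, exists2 u, tdeg (2 * m) u & L1 u != 0 &
    exists f, [/\ tdeg m f, L1 (f ^+ 2) = 0 & ~ exists q, f = q * h]].
Proof.
move=> pL nzL; have [linL Lh psd] := pL.
have [[f [df Lf nf]]|nof] := EM (exists f, [/\ tdeg m f, L (f ^+ 2) = 0 & ~ exists q, f = q * h]).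
  by exists L; split => //; exists f.
have null f : tdeg m f -> L (f ^+ 2) = 0 -> exists q, f = q * h.
  by move=> df Lf; apply: contrapT => nf; apply: nof; exists f.
pose Lt t u := L u - t * rem_coef0 u.
have linLt t : functional (Lt t).
  by move=> c u v; rewrite /Lt linL functional_rem_coef0; ring.
have Lth t u : tdeg (2 * m - n) u -> Lt t (h * u) = 0.
  by move=> du; rewrite /Lt Lh // rem_coef0_mul mulr0 subr0.
pose T := [set t : R | 0 <= t /\ forall u, tdeg m u -> 0 <= Lt t (u ^+ 2)]%classic.
have T0 : T 0 by split => // u du; rewrite /Lt mul0r subr0; apply: psd.
have one : rem_coef0 1 = 1.
  by rewrite rem_coef0_small ?size_poly1 // coefC /= coefC.
have ubT : ubound T (L 1).
  move=> t [_ /(_ 1 (@tdeg1 _ _))]; rewrite /Lt expr1n one mulr1 subr_ge0 //.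
have hasub : has_ubound T by exists (L 1).
pose t := sup T.
have t0 : 0 <= t by apply: ub_le_sup.
have pt : psd_mod n m h (Lt t).
  split; [exact: linLt|exact: Lth|move=> u du].
  have [neg|pos] := leP (rem_coef0 (u ^+ 2)) 0.
    by rewrite /Lt; have := psd _ du; nra.
  rewrite /Lt subr_ge0 -ler_pdivlMr //; apply: ge_sup; first by exists 0.
  move=> s [s0 /(_ u du)]; by rewrite /Lt subr_ge0 -ler_pdivlMr.
have Tt : T t by case: pt.
have m0 : (0 < m)%N by apply: leq_trans nm.
(* The value at x^2 does not change with t, and L(x^2) is nonzero since x is not a multiple of
   [h]. *)
pose x := mon R 1 0.
have dx : tdeg m x by apply: tdeg_mon.
have x2 : x ^+ 2 = mon R 2 0 by rewrite expr2 monM.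
have nx : ~ exists q, x = q * h.
  move=> [q xE]; have [q0|q0] := eqVneq q 0.
    have := coef_mon R 1 0 1 0; rewrite -/x xE q0 mul0r !coef0 eqxx => /eqP.
    by rewrite eq_sym oner_eq0.
  have : size x = (size q + n)%N.
    have lh : lead_coef q * lead_coef h != 0.
      by rewrite mulf_neq0 ?lead_coef_eq0 // -size_poly_gt0 (size_ydeg dh hn).
    by rewrite xE size_proper_mul // (size_ydeg dh hn) addnS.
  have : (size x <= 1)%N.
    by rewrite /x /mon expr0; apply: leq_trans (size_scale_leq _ _) _; rewrite size_poly1.
  have : (0 < size q)%N by rewrite size_poly_gt0.
  by move: (size x) (size q) => a b; lia.
exists (Lt t); split => //.
  exists (x ^+ 2); first by rewrite x2; apply: tdeg_mon; lia.
  rewrite /Lt x2 rem_coef0_small.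
    rewrite coef_mon /= mulr0 subr0; apply/eqP => Lx; apply: nx; apply: null => //.
    by rewrite x2.
  rewrite /mon expr0; apply: leq_trans (size_scale_leq _ _) _; by rewrite size_poly1.
apply: contrapT => nof'.
have null' f : tdeg m f -> Lt t (f ^+ 2) = 0 -> exists q, f = q * h.
  by move=> df Lf; apply: contrapT => nf; apply: nof'; exists f.
pose s := map (@mon_pair R) monomials.
have ds i : (i < size s)%N -> tdeg m s`_i.
  rewrite size_map => si; rewrite (nth_map (0, 0)%N) //.
  have := mem_nth (0, 0)%N si; case: (nth _ _ _) => a b; rewrite mem_monomials.
  by move=> /andP[ab _]; apply: tdeg_mon.
have szs (c : 'rV_(size s)) : (size (lcomb c) <= n)%N.
  apply/leq_sizeP => b nb; apply/polyP => a; rewrite coef0 lcomb_monp_coef big1 // => j _.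
  rewrite (_ : _ == _ = false) ?mulr0 //; apply/negP => /eqP e.
  have : nth (0, 0)%N monomials j \in monomials by apply: mem_nth;
    rewrite -(size_map (@mon_pair R)).
  by rewrite e mem_monomials => /andP[_]; lia.
have dcomb (c : 'rV_(size s)) : tdeg m (lcomb c).
  by apply: tdeg_sum => j _; apply/tdegCZ/ds.
have pd (c : 'rV_(size s)) : Lt t (lcomb c ^+ 2) = 0 -> c = 0.
  move=> /(null' _ (dcomb c))[q e]; apply: lcomb_monp_inj; first exact: monomials_uniq.
  have := modp_small (p := lcomb c) (q := h); rewrite (size_ydeg dh hn) ltnS => /(_ (szs c)) <-.
  by rewrite e modp_mull.
have [linLt' _ psdt] := pt.
have [M M0 dom] := psd_dominates linLt' functional_rem_coef0 psdt ds pd.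
(* M + 1 instead of M, which may be 0. *)
pose eps := (M + 1)^-1.
have M1 : 0 < M + 1 by lra.
have eps0 : 0 < eps by rewrite invr_gt0.
have Teps : T (t + eps).
  split; first lra.
  move=> u du; have [q [r [dq dr sr uE]]] := divide_tdeg dh hn nm du.
  have [c cE] := remainder_lcomb dr sr.
  have -> : Lt (t + eps) (u ^+ 2) = Lt t (u ^+ 2) - eps * rem_coef0 (u ^+ 2) by rewrite /Lt; ring.
  have -> : Lt t (u ^+ 2) = Lt t (r ^+ 2) by rewrite uE psd_mod_remainder.
  have -> : rem_coef0 (u ^+ 2) = rem_coef0 (r ^+ 2).
    have -> : u ^+ 2 = h * (q * (q * h + 2%:R * r)) + r ^+ 2 by rewrite uE; ring.
    by rewrite (functionalD functional_rem_coef0) rem_coef0_mul add0r.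
  have := dom c; have := psdt _ dr; rewrite -/s -cE => p1 p2.
  rewrite subr_ge0 /eps mulrC ler_pdivrMr //; nra.
by have := ub_le_sup hasub Teps; rewrite -/t; lra.
Qed.

End NullVector.

(** * Induction on the degree of the curve *)

Section Core.
Variable R : realType.
Implicit Types (h f a b u v : {poly {poly R}}) (n m : nat) (L : {poly {poly R}} -> R).

Lemma exists_nonroot (r : {poly R}) : r != 0 -> exists x, ~~ root r x.
Proof.
move=> r0; apply: contrapT => nr.
pose s := [seq k%:R : R | k <- iota 0 (size r)].
have := @max_poly_roots _ r s r0; rewrite size_map size_iota ltnn => H.
suff : false by []. apply: H.
  by apply/allP => x _; apply: contrapT => /negP nx; apply: nr; exists x.
by rewrite map_inj_uniq ?iota_uniq // => i j /eqP; rewrite eqr_nat => /eqP.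
Qed.

Lemma coprime_or_factor_ydeg n h f : tdeg n h -> h`_n`_0 != 0 -> (0 < n)%N ->
    ~ (exists q, f = q * h) ->
  (exists a b r, r != 0 /\ a * h + b * f = r%:P) \/
  (exists a b, [/\ h = a * b, (1 < size a < size h)%N & (1 < size b < size h)%N]).
Proof.
move=> dh hn n0 nf; set c := h`_n`_0; have sh := size_ydeg dh hn.
have c0 : c%:P != 0 by rewrite polyC_eq0.
pose h1 := (c^-1)%:P *: h.
have cV : c%:P * (c^-1)%:P = 1 by rewrite -polyCM mulfV.
have hE : h = c%:P *: h1 by rewrite scalerA cV scale1r.
have s1 : size h1 = size h by rewrite size_scale // polyC_eq0 invr_eq0.
have m1 : h1 \is monic.
  by rewrite monicE lead_coefZ (lead_coef_ydeg dh hn) -/c mulrC cV.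
have [||[a [b [r [r0 e]]]]|[a [b [e sa sb]]]] := coprime_or_factor (h := h1) (f := f) m1.
- by rewrite s1 sh.
- by move=> [q e]; apply: nf; exists ((c^-1)%:P *: q); rewrite e /h1 -scalerAl scalerAr.
- by left; exists ((c^-1)%:P *: a), b, r; rewrite -e -scalerAl scalerAr.
- right; exists (c%:P *: a), b; rewrite size_scale // -s1; split => //.
  by rewrite [LHS]hE e scalerAl.
Qed.

(** The degrees in y of the factors add up to n, their total degrees to at most n. As the former are
    bounded by the latter, they agree, and [form_value] is multiplicative. *)
Lemma rootless_factor n h a b : tdeg n h -> rootless n h -> h = a * b ->
    (1 < size a < size h)%N -> (1 < size b < size h)%N ->
  exists i j, [/\ (i < n)%N, (j < n)%N, (i + j = n)%N, tdeg i a /\ tdeg j b &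
    rootless i a /\ rootless j b].
Proof.
move=> dh hr e /andP[a1 ah] /andP[b1 bh]; have sh := size_ydeg dh (rootless_pole hr).
have a0 : a != 0 by rewrite -size_poly_gt0 ltnW.
have b0 : b != 0 by rewrite -size_poly_gt0 ltnW.
have [i [da ta]] := exact_tdeg a0; have [j [db tb]] := exact_tdeg b0.
have ijn : (i + j <= n)%N.
  rewrite leqNgt; apply/negP => lt; have := top_lt dh lt.
  by rewrite e topM // => /eqP; rewrite mulf_eq0 (negbTE ta) (negbTE tb).
have small k u : tdeg k u -> (size u <= k.+1)%N.
  by move=> du; apply/leq_sizeP => l kl; apply/polyP => z; rewrite coef0; apply: du; lia.
have sa := small _ _ da; have sb := small _ _ db.
have sab : (n.+2 = size a + size b)%N.
  by rewrite -[n.+2]/(n.+1.+1) -sh e size_mul // prednK // addn_gt0 (ltnW a1).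
have [ia ib] : (size a = i.+1 /\ size b = j.+1)%N.
  by move: sa sb sab; move: (size a) (size b) => x y; lia.
have ijE : (i + j = n)%N by move: sab; rewrite ia ib; lia.
exists i, j; split => //; try by move: ah bh a1 b1; rewrite sh ia ib; lia.
split => x y z xyz; have := hr x y z xyz;
  by rewrite /form_value e -ijE homogM // mulf_eq0 negb_or => /andP[].
Qed.

Definition vanishes n := forall m h L, (n <= m)%N -> tdeg n h -> rootless n h ->
  psd_mod n m h L -> forall u, tdeg (2 * m) u -> L u = 0.

Lemma psd_mod_null n m h L f : psd_mod n m h L -> tdeg m f -> L (f ^+ 2) = 0 ->
  forall u, tdeg m u -> L (f * u) = 0.
Proof.
move=> [linL _ psd] df f0 u du; apply: psd_null => // t; apply: psd.
by apply: tdegD => //; apply: tdegCZ.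
Qed.

(* L(a^2 .) is again positive and kills b, so it vanishes; hence a is null for L. *)
Lemma vanish_factor n m h L a b : (forall k, (k < n)%N -> vanishes k) ->
  (n <= m)%N -> tdeg n h -> rootless n h -> psd_mod n m h L -> h = a * b ->
  (1 < size a < size h)%N -> (1 < size b < size h)%N ->
  forall u, tdeg (2 * m) u -> L u = 0.
Proof.
move=> IH nm dh hr pL e sa sb; have [linL Lh psd] := pL.
have [i [j [lin ljn ijn [da db] [ra rb]]]] := rootless_factor dh hr e sa sb.
have mi : (m = i + (m - i))%N by lia.
have La2 u : tdeg (2 * (m - i)) u -> L (a ^+ 2 * u) = 0.
  apply: (IH j ljn (m - i)%N b (fun v => L (a ^+ 2 * v))) => //; first by lia.
  split.
  - exact: functional_mul.
  - move=> v dv; have -> : a ^+ 2 * (b * v) = h * (a * v) by rewrite e; ring.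
    apply: Lh; have -> : (2 * m - n = i + (2 * (m - i) - j))%N by lia.
    exact: tdegM.
  - move=> v dv; rewrite -exprMn; apply: psd.
    by rewrite mi; apply: tdegM.
have Lau v w : tdeg (m - i) v -> tdeg m w -> L (a * v * w) = 0.
  move=> dv dw; apply: (psd_mod_null pL) => //; first by rewrite mi; apply: tdegM.
  rewrite exprMn La2 // mul2n -addnn expr2; exact: tdegM.
apply: (IH i lin m a L) => //; first by lia.
split => // u du; rewrite mulrC; apply: functional_mono => // k l kl.
have kl2 : (k + l <= 2 * m - i)%N.
  by rewrite leqNgt; apply/negP => lt; move: kl; rewrite du ?eqxx.
(* A monomial of degree at most 2m - i splits into one of degree at most m - i, which joins the null
   vector [a], and one of degree at most m. *)
have [k1 [l1 [kk ll d1 d2]]] : exists k1 l1,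
    [/\ (k1 <= k)%N, (l1 <= l)%N, (k1 + l1 <= m - i)%N & (k - k1 + (l - l1) <= m)%N].
  exists (minn k (m - i)), (minn l (m - i - k)); split; lia.
have -> : mon R k l * a = a * mon R k1 l1 * mon R (k - k1) (l - l1).
  by rewrite -mulrA monM subnKC // subnKC // mulrC.
by apply: Lau; apply: tdeg_mon.
Qed.

Lemma vanish n : vanishes n.
Proof.
have [k] := ubnP n; elim: k n => // k IHk n nk m h L nm dh hr pL.
have IH i : (i < n)%N -> vanishes i by move=> lt; apply: IHk; lia.
have hn := rootless_pole hr; have [linL Lh psd] := pL.
have [n0|n0] := posnP n.
  move=> u du; have hE : h = (h`_0`_0)%:P *: 1.
    by move: dh; rewrite n0 => /mon_expand; rewrite !big_ord1 mon00.
  have c0 : h`_0`_0 != 0 by rewrite -{1}n0.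
  have -> : u = h * ((h`_0`_0)^-1%:P *: u).
    by rewrite {1}hE -scalerAl mul1r scalerA -polyCM mulfV // scale1r.
  by apply: Lh; rewrite n0 subn0; apply: tdegCZ.
suff : ~ exists2 u, tdeg (2 * m) u & L u != 0.
  by move=> H u du; apply/eqP/negP => /negP Lu; apply: H; exists u.
move=> /(exists_null_vector n0 nm dh hn pL)[L1 [pL1 [u du /eqP Lu] [f [df f0 nf]]]].
apply: Lu; have [linL1 L1h psd1] := pL1.
have L1f := psd_mod_null pL1 df f0.
have [[a [b [r [r0 e]]]]|[a [b [e sa sb]]]] := coprime_or_factor_ydeg dh hn n0 nf; last first.
  exact: (vanish_factor IH nm dh hr pL1 e).
(* Since r(x0) is nonzero, [e] at x = x0 is a Bezout relation between h(x0, y) and f(x0, y), the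
   leading forms in the new chart. *)
have [x0 rx] := exists_nonroot r0.
pose h2 := chart x0 n h; pose f2 := chart x0 m f.
have dh2 : tdeg n h2 by exact: tdeg_chart.
have df2 : tdeg m f2 by exact: tdeg_chart.
have hr2 : rootless n h2 by apply: rootless_chart.
have hn2 := rootless_pole hr2.
pose L2 v := L1 (unchart x0 (2 * m) v).
have L2M i v w : (i <= 2 * m)%N -> tdeg i v -> tdeg (2 * m - i) w ->
    L2 (v * w) = L1 (unchart x0 i v * unchart x0 (2 * m - i) w).
  by move=> i2 dv dw; rewrite /L2 -unchartM // subnKC.
have linL2 : functional L2 by move=> c v w; rewrite /L2 unchart_linear linL1.
have sqr v : tdeg m v -> L2 (v ^+ 2) = L1 (unchart x0 m v ^+ 2).
  move=> dv; rewrite !expr2 (L2M m) //; first by rewrite (_ : (2 * m - m = m)%N) //; lia.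
    by lia.
  by rewrite (_ : (2 * m - m = m)%N) //; lia.
have pL2 : psd_mod n m h2 L2.
  split => // v dv; last by rewrite sqr //; apply/psd1/tdeg_unchart.
  rewrite (L2M n) //; last by lia.
  by rewrite chartK // L1h //; apply: tdeg_unchart.
have L2f v : tdeg m v -> L2 (f2 * v) = 0.
  move=> dv; have mm : (2 * m - m = m)%N by lia.
  rewrite (L2M m) ?mm //; last by lia.
  by rewrite chartK // L1f //; apply: tdeg_unchart.
suff van v : tdeg (2 * m) v -> L2 v = 0.
  by rewrite -(chartK x0 du); apply/van/tdeg_chart.
have cop : coprimep (top_form n h2) (top_form m f2).
  rewrite !top_chart //; apply/Bezout_eq1_coprimepP.
  pose ev u : {poly R} := map_poly (horner_eval x0) u.
  exists ((r.[x0]^-1)%:P * ev a, (r.[x0]^-1)%:P * ev b) => /=.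
  have := congr1 ev e; rewrite /ev rmorphD !rmorphM /= map_polyC /= /horner_eval => eE.
  by rewrite -!mulrA -mulrDr eE -polyCM mulVf.
have nf2 : ~ exists q, f2 = q * h2.
  move=> [q qE]; suff : top_form n h2 %| top_form m f2.
    move=> dv; have := size_top_h hn2.
    have := coprimep_dvdl dv cop; rewrite coprimepp => /eqP -> [] n0'.
    by rewrite -n0' in n0.
  have [q0|q0] := eqVneq q 0.
    rewrite qE q0 mul0r (_ : top_form m 0 = 0) ?dvdp0 //.
    by apply/polyP => l; rewrite coef_top !coef0 if_same.
  have [i [dq tq]] := exact_tdeg q0.
  have tm := topM dq dh2.
  have h20 : top_form n h2 != 0 by rewrite -size_poly_gt0 (size_top_h hn2).
  have inm : (i + n <= m)%N.
    rewrite leqNgt; apply/negP => lt; have := top_lt df2 lt.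
    by rewrite qE tm => /eqP; rewrite mulf_eq0 (negbTE tq) (negbTE h20).
  have dq' : tdeg (m - n) q by apply: tdegW dq; lia.
  by have := topM dq' dh2; rewrite subnK // -qE => ->; rewrite dvdp_mull.
(* The elimination is repeated because [r] is a polynomial in the old x; a factorization found in
   the new chart serves the induction as well. *)
have [[a2 [b2 [r2 [r20 e2]]]]|[a2 [b2 [e2 sa sb]]]] :=
    coprime_or_factor_ydeg dh2 hn2 n0 nf2; last first.
  exact: (vanish_factor IH nm dh2 hr2 pL2 e2).
have [_ L2h psd2] := pL2.
apply: (vanish_coprime_tops dh2 df2 hn2 cop linL2 nm
  (fun x y => rootless_affine x y dh2 hr2) r20) => //.
by exists a2, b2.
Qed.

End Core.

(** * Separation of a point from the core of a convex cone *)

Section HahnBanach.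
Variables (R : realType) (V : lmodType R) (p : V -> R).
Hypotheses (pD : forall u v, p (u + v) <= p u + p v)
  (pZ : forall c u, 0 < c -> p (c *: u) <= c * p u) (p0 : 0 <= p 0).

(** The functional is extended one vector at a time. Inequalities between coefficients avoid
    subspaces, and also force the values to respect linear relations in [b]. *)
Lemma hahn_banach (b : seq V) : exists c : nat -> R, forall a : nat -> R,
  \sum_(i < size b) a i * c i <= p (\sum_(i < size b) a i *: b`_i).
Proof.
elim/last_ind: b => [|b w [c IH]].
  by exists (fun=> 0) => a; rewrite !big_ord0.
pose f (a : nat -> R) : R := \sum_(i < size b) a i * c i.
pose g (a : nat -> R) : V := \sum_(i < size b) a i *: b`_i.
have fD a a' : f (fun i => a i + a' i) = f a + f a'.
  by rewrite -big_split; apply: eq_bigr => i _; rewrite mulrDl.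
have gD a a' : g (fun i => a i + a' i) = g a + g a'.
  by rewrite -big_split; apply: eq_bigr => i _; rewrite scalerDl.
have fZ t a : f (fun i => t * a i) = t * f a.
  by rewrite mulr_sumr; apply: eq_bigr => i _; rewrite mulrA.
have gZ t a : g (fun i => t * a i) = t *: g a.
  by rewrite scaler_sumr; apply: eq_bigr => i _; rewrite scalerA.
have {}IH a : f a <= p (g a) := IH a.
pose S := [set s : R | exists a, s = f a - p (g a - w)]%classic.
have Sub a : ubound S (p (g a + w) - f a).
  move=> _ [a' ->]; rewrite lerBrDr addrAC lerBlDr -fD; apply: le_trans (IH _) _.
  by rewrite gD; have -> : g a' + g a = g a + w + (g a' - w);
    [rewrite [RHS]addrACA subrr addr0 addrC|exact: pD].
have S0 : (S !=set0)%classic by exists (f (fun=> 0) - p (g (fun=> 0) - w)); exists (fun=> 0).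
pose cw := sup S.
have up a : f a + cw <= p (g a + w).
  by rewrite addrC -lerBrDr; apply: ge_sup.
have lo a : f a - cw <= p (g a - w).
  rewrite lerBlDr -lerBlDl; apply: ub_le_sup; last by exists a.
  by exists (p (g a + w) - f a).
exists (fun i => if (i < size b)%N then c i else cw) => a.
rewrite size_rcons !big_ord_recr /= ltnn nth_rcons ltnn eqxx.
have -> : \sum_(i < size b) a i * (if (i < size b)%N then c i else cw) = f a.
  by apply: eq_bigr => i _; rewrite ltn_ord.
have -> : \sum_(i < size b) a i *: (rcons b w)`_i = g a.
  by apply: eq_bigr => i _; rewrite nth_rcons ltn_ord.
set t := a (size b).
(* The reverse bound s p(y) <= p(s y) comes from [pZ] with s^-1. *)
have scale s a' (v : V) x : 0 < s -> f a' + x <= p (g a' + v) ->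
    s * f a' + s * x <= p (s *: g a' + s *: v).
  move=> s0 le; rewrite -mulrDr -scalerDr; set y := g a' + v in le *.
  have := pZ (s *: y) (c := s^-1); rewrite scalerA mulVf ?gt_eqF // scale1r invr_gt0.
  move=> /(_ s0) le2; have : s * p y <= s * (s^-1 * p (s *: y)) by rewrite ler_pM2l.
  by rewrite mulrA mulfV ?gt_eqF // mul1r; apply: le_trans; rewrite ler_pM2l.
have fK s : s != 0 -> f a = s * f (fun i => s^-1 * a i).
  by move=> s0; rewrite -fZ; apply: eq_bigr => i _; rewrite mulVKf.
have gK s : s != 0 -> g a = s *: g (fun i => s^-1 * a i).
  by move=> s0; rewrite -gZ; apply: eq_bigr => i _; rewrite mulVKf.
have [t0|t0|t0] := ltrgtP t 0.
- have nt : 0 < - t by rewrite oppr_gt0.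
  have := scale (- t) _ (- w) (- cw) nt (lo (fun i => (- t)^-1 * a i)).
  by rewrite -fK ?gt_eqF // -gK ?gt_eqF // mulrNN scalerN scaleNr opprK.
- have := scale t _ w cw t0 (up (fun i => t^-1 * a i)).
  by rewrite -fK ?gt_eqF // -gK ?gt_eqF.
- by rewrite t0 mul0r scale0r !addr0.
Qed.

End HahnBanach.

Definition convex_cone (R : realType) (V : lmodType R) (C : V -> Prop) : Prop :=
  (forall u v, C u -> C v -> C (u + v)) /\ (forall c u, 0 <= c -> C u -> C (c *: u)).

Definition order_unit (R : realType) (V : lmodType R) (C : V -> Prop) (e : V) : Prop :=
  forall u, exists N, C (N *: e + u).

Section CorePoint.
Variables (R : realType) (V : vectType R).
Implicit Types (C : V -> Prop) (e q u v : V).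

(** Hahn-Banach for the gauge p(u), the infimum of the t with t e - u in [C]. It is finite because
    [e] is an order unit and - e is not in [C]; on - u with u in [C] it is at most 0, and at - e at
    most -1. *)
Lemma order_unit_functional C e : convex_cone C -> order_unit C e -> C e -> ~ C (- e) ->
  exists phi : V -> R, [/\ forall c u v, phi (c *: u + v) = c * phi u + phi v,
    forall u, C u -> 0 <= phi u & phi e != 0].
Proof.
move=> [CD CZ] ou Ce Cne.
pose T u := [set t : R | C (t *: e - u)]%classic.
have Ce0 t : C (t *: e) -> 0 <= t.
  move=> Ct; rewrite leNgt; apply/negP => t0; apply: Cne.
  have -> : - e = (- t)^-1 *: (t *: e).
    by rewrite scalerA invrN mulNr mulVf ?lt_eqF // scaleN1r.
  by apply: CZ; rewrite ?invr_ge0 ?oppr_ge0 ?ltW.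
have Tn u : (T u !=set0)%classic by have [N CN] := ou (- u); exists N.
have Tlb u : has_lbound (T u).
  have [N CN] := ou u; exists (- N) => t Tt.
  rewrite lerNl -subr_ge0 opprK; apply: Ce0; rewrite scalerDl.
  by have := CD _ _ CN Tt; rewrite addrACA subrr addr0.
pose p u := inf (T u).
have plow u t : T u t -> p u <= t by move=> Tt; apply: ge_inf.
have pgreat u x : (forall t, T u t -> x <= t) -> x <= p u.
  by move=> H; apply: lb_le_inf.
have pD u v : p (u + v) <= p u + p v.
  rewrite -lerBlDr; apply: (pgreat) => t Tt; rewrite lerBlDr -lerBlDl.
  apply: pgreat => s Ts; rewrite lerBlDl; apply: plow; rewrite /T /= scalerDl opprD addrACA.
  exact: CD.
have pZ c u : 0 < c -> p (c *: u) <= c * p u.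
  move=> c0; rewrite -ler_pdivrMl //; apply: pgreat => t Tt.
  rewrite ler_pdivrMl //; apply: plow; rewrite /T /= -scalerA -scalerBr.
  by apply: CZ => //; apply: ltW.
have p0 : 0 <= p 0 by apply: pgreat => t; rewrite /T /= subr0; apply: Ce0.
pose b := vbasis (fullv : {vspace V}).
have [c H] := hahn_banach pD pZ p0 b.
pose phi u : R := \sum_(i < size b) coord b (cast_ord (size_tuple b) i) u * c i.
have uE u : u = \sum_(i < size b) coord b (cast_ord (size_tuple b) i) u *: b`_i.
  rewrite {1}(coord_vbasis (memvf u)) (reindex (cast_ord (size_tuple b))) //=.
  by exists (cast_ord (esym (size_tuple b))) => i _; rewrite ?cast_ordK ?cast_ordKV.
have phip u : phi u <= p u.
  pose a (i : nat) := if insub i is Some j then coord b (cast_ord (size_tuple b) j) u else 0.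
  have aE (i : 'I_(size b)) : a i = coord b (cast_ord (size_tuple b) i) u.
    by rewrite /a valK.
  have := H a; under eq_bigr => i _ do rewrite aE.
  by under [X in _ <= p X]eq_bigr => i _ do rewrite aE; rewrite -uE.
have lin k u v : phi (k *: u + v) = k * phi u + phi v.
  rewrite mulr_sumr -big_split; apply: eq_bigr => i _ /=.
  by rewrite linearP mulrDl mulrA.
have phi0 : phi 0 = 0 by rewrite /phi big1 // => i _; rewrite linear0 mul0r.
have phiN u : phi (- u) = - phi u.
  by have := lin (-1) u 0; rewrite addr0 scaleN1r mulN1r phi0 addr0.
exists phi; split => //.
- move=> u Cu; rewrite -oppr_le0 -phiN; apply: le_trans (phip _) _.
  by apply: plow; rewrite /T /= scale0r opprK add0r.
- have : phi (- e) <= -1.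
    apply: le_trans (phip _) _; apply: plow.
    by rewrite /T /= scaleN1r opprK addNr -(scale0r e); apply: CZ.
  by rewrite phiN; apply: contraTneq => ->; rewrite oppr0 lerNr oppr0 ler10.
Qed.

(** If some [f] lies outside the cone [K] of the u with u + N q in [C], then - e does too, and a
    functional separates. [K] contains [q] and - q, so this functional vanishes at [q], contrary to
    [sep]. *)
Lemma core_point C e q : convex_cone C -> order_unit C e -> C e -> C q ->
  (forall phi : V -> R, (forall c u v, phi (c *: u + v) = c * phi u + phi v) ->
    (forall u, C u -> 0 <= phi u) -> phi q = 0 -> forall u, phi u = 0) ->
  forall f, exists2 eps, 0 < eps & C (q + eps *: f).
Proof.
move=> coneC ou Ce Cq sep f; have [CD CZ] := coneC.
pose K u := exists2 N, 0 <= N & C (u + N *: q).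
suff [N N0 CN] : K f.
  exists (N + 1)^-1; first by rewrite invr_gt0 ltr_wpDl.
  have -> : q + (N + 1)^-1 *: f = (N + 1)^-1 *: ((f + N *: q) + q).
    have N1 : N + 1 != 0 by rewrite gt_eqF // ltr_wpDl.
    by rewrite -addrA -{3}[q]scale1r -scalerDl scalerDr scalerA mulVf // scale1r addrC.
  by apply: CZ; [rewrite invr_ge0 addr_ge0|exact: CD].
have CK u : C u -> K u by move=> Cu; exists 0; rewrite ?scale0r ?addr0.
have KD u v : K u -> K v -> K (u + v).
  move=> [N N0 CN] [M M0 CM]; exists (N + M); first exact: addr_ge0.
  by rewrite scalerDl addrACA; apply: CD.
have KZ c u : 0 <= c -> K u -> K (c *: u).
  move=> c0 [N N0 CN]; exists (c * N); first exact: mulr_ge0.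
  by rewrite -scalerA -scalerDr; apply: CZ.
apply: contrapT => nKf.
have Kne : ~ K (- e).
  move=> Kne; apply: nKf; have [N CN] := ou f; have [N0|N0] := leP 0 N.
    have := KD _ _ (CK _ CN) (KZ _ _ N0 Kne).
    by rewrite scalerN addrAC subrr add0r.
  have : C (- N *: e) by apply: CZ => //; rewrite oppr_ge0 ltW.
  by move=> /(CD _ _ CN); rewrite scaleNr addrAC subrr add0r => /CK.
have ouK : order_unit K e by move=> u; have [N CN] := ou u; exists N; apply: CK.
have [phi [lin pos /eqP[]]] := order_unit_functional (conj KD KZ) ouK (CK _ Ce) Kne.
apply: sep => // [u Cu|]; first by apply/pos/CK.
have phiq : 0 <= phi q by apply/pos/CK.
have Knq : K (- q).
  by exists 1; rewrite ?scale1r ?addNr //; rewrite -(scale0r q); apply: CZ.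
have phi0 : phi 0 = 0.
  by have := lin 1 0 0; rewrite scaler0 addr0 mul1r => /eqP;
    rewrite -subr_eq0 opprD addNKr oppr_eq0 => /eqP.
have := pos _ Knq; have := lin (-1) q 0; rewrite scaleN1r addr0 phi0 => ->; lra.
Qed.

End CorePoint.

(** * Ternary forms *)

Section Forms.
Variable R : realType.
Implicit Types (u v : {poly {poly R}}).

Let X (i : 'I_3) : mpoly 3 R := mpolyX R (mnm1 i).

Let i0 : 'I_3 := inord 0.
Let i1 : 'I_3 := inord 1.
Let i2 : 'I_3 := inord 2.

Definition homog_mpoly k u : mpoly 3 R := homog (@mpolyC 3 R) (X i0) (X i1) (X i2) k u.

Lemma homog_mpoly_dhomog k u : homog_mpoly k u \is ishomog1 k mdeg.
Proof.
have dX i a : X i ^+ a \is ishomog1 a mdeg.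
  by rewrite -[in ishomog1 a _](mul1n a); apply: dhomogMn; rewrite dhomogX /= mdeg1.
apply: rpred_sum => -[a b] /= ab; rewrite mul_mpolyC; apply: rpredZ.
have := dhomogM (dhomogM (dX i0 a) (dX i1 b)) (dX i2 (k - a - b)%N).
by have -> : (a + b + (k - a - b) = k)%N by lia.
Qed.

Definition form_of k u : ternary_form R k := DHomog (homog_mpoly_dhomog k u).

Lemma form_of_linear k c u v :
  form_of k (c%:P *: u + v) = c *: form_of k u + form_of k v.
Proof. by apply: val_inj; rewrite /= /homog_mpoly homog_linear mul_mpolyC. Qed.

Lemma form_of_sqr k u : tdeg k u -> form_of (2 * k) (u ^+ 2) = form_sqr (form_of k u).
Proof.
move=> du; apply: val_inj; rewrite /= /homog_mpoly.
by have [-> _] := homogX (@mpolyC 3 R) (X i0) (X i1) (X i2) 2 du.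
Qed.

Definition poly_of k (p : ternary_form R k) : {poly {poly R}} :=
  \sum_(m <- msupp (mpoly_of_dhomog p)) (mcoeff m (mpoly_of_dhomog p))%:P *: mon R (m i0) (m i1).

Lemma mdeg3 (m : multinom 3) : mdeg m = (m i0 + m i1 + m i2)%N.
Proof.
rewrite mdegE !big_ord_recl big_ord0 addn0 addnA.
by congr (m _ + m _ + m _)%N; apply: val_inj; rewrite /= inordK.
Qed.

Lemma msupp_mdeg k (p : ternary_form R k) m : m \in msupp (mpoly_of_dhomog p) ->
  (m i0 + m i1 + m i2 = k)%N.
Proof. by rewrite -mdeg3; apply: dhomog_mf; apply: dhomog_is_dhomog. Qed.

Lemma tdeg_poly_of k (p : ternary_form R k) : tdeg k (poly_of p).
Proof.
rewrite /poly_of big_seq; apply: tdeg_sum => m /msupp_mdeg mk.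
by apply/tdegCZ/tdeg_mon; lia.
Qed.

Lemma poly_ofK k (p : ternary_form R k) : form_of k (poly_of p) = p.
Proof.
apply: val_inj; rewrite /= /homog_mpoly homog_sum [RHS](mpolyE (mpoly_of_dhomog p)).
apply: eq_big_seq => m mp; have mk := msupp_mdeg mp.
rewrite mul_mpolyC homog_mon; last by lia.
congr (_ *: _); rewrite mpolyXE_id !big_ord_recl big_ord0 mulr1 mulrA.
have -> : (k - m i0 - m i1 = m i2)%N by lia.
by congr (X _ ^+ m _ * X _ ^+ m _ * X _ ^+ m _); apply: val_inj; rewrite /= inordK.
Qed.

Lemma form_eval_value k (p : ternary_form R k) (w : 'rV[R]_3) :
  form_eval p w = form_value (w 0 i0) (w 0 i1) (w 0 i2) k (poly_of p).
Proof.
rewrite /form_eval -[in LHS](poly_ofK p) [LHS]rmorph_homog /= !mevalXU.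
by apply: eq_bigr => s _; rewrite /= mevalC.
Qed.

Lemma rootless_poly_of k (p : ternary_form R k) : strictly_positive p -> rootless k (poly_of p).
Proof.
move=> pos x y z xyz.
pose w : 'rV[R]_3 := \row_j (if j == i0 then x else if j == i1 then y else z).
have [e0 e1 e2] : [/\ w 0 i0 = x, w 0 i1 = y & w 0 i2 = z].
  by rewrite !mxE -!val_eqE /= !inordK.
rewrite -e0 -e1 -e2 -form_eval_value gt_eqF // pos //; apply/eqP => w0.
by apply: xyz; split; [rewrite -e0|rewrite -e1|rewrite -e2]; rewrite w0 mxE.
Qed.

(** * The cone of sums of squares *)

Section SosCone.
Variable k : nat.

Lemma form_sqrZ c (g : ternary_form R k) : form_sqr (c *: g) = c ^+ 2 *: form_sqr g.
Proof. by apply: val_inj; rewrite /= exprZn. Qed.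

Lemma sos_cone_convex : convex_cone (@sos_cone R k).
Proof.
split=> [u v [s ->] [t ->]|c u c0 [s ->]]; first by exists (s ++ t); rewrite big_cat.
exists [seq Num.sqrt c *: g | g <- s].
by rewrite big_map scaler_sumr; apply: eq_bigr => g _; rewrite form_sqrZ sqr_sqrtr.
Qed.

Lemma form_sqr_sos (g : ternary_form R k) : sos_cone (form_sqr g).
Proof. by exists [:: g]; rewrite big_seq1. Qed.

Let mono (s : 'I_k.+1 * 'I_k.+1) : ternary_form R k := form_of k (mon R s.1 s.2).

Let unit_sos : ternary_form R (2 * k) :=
  \sum_(s : 'I_k.+1 * 'I_k.+1 | (s.1 + s.2 <= k)%N) form_sqr (mono s).

(** A monomial of degree 2k is a product A B of two of degree k, and 2 A B or - 2 A B becomes a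
    square after adding A^2 + B^2. *)
Lemma sos_cone_order_unit : sos_cone unit_sos /\ order_unit (@sos_cone R k) unit_sos.
Proof.
have [CD CZ] := sos_cone_convex; have C0 : sos_cone (0 : ternary_form R (2 * k)).
  by exists [::]; rewrite big_nil.
have Csum (r : seq ('I_k.+1 * 'I_k.+1)) Q : sos_cone (\sum_(s <- r | Q s) form_sqr (mono s)).
  by elim/big_rec: _ => // s w _ Cw; apply: CD => //; apply: form_sqr_sos.
split; first exact: Csum.
pose O (w : ternary_form R (2 * k)) := exists2 N, 0 <= N & sos_cone (N *: unit_sos + w).
suff H w : O w by move=> v; have [N _ CN] := H v; exists N.
have OD w1 w2 : O w1 -> O w2 -> O (w1 + w2).
  move=> [N N0 CN] [M M0 CM]; exists (N + M); first exact: addr_ge0.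
  by rewrite scalerDl addrACA; apply: CD.
have rest a b : (a + b <= k)%N ->
    sos_cone (unit_sos - form_sqr (form_of k (mon R a b))).
  move=> ab; have ak : (a < k.+1)%N by lia. have bk : (b < k.+1)%N by lia.
  rewrite -[form_sqr _]/(form_sqr (mono (Ordinal ak, Ordinal bk))).
  rewrite /unit_sos (bigD1 (Ordinal ak, Ordinal bk)) // [X in X - _]addrC addrK.
  exact: Csum.
rewrite -(poly_ofK w) /poly_of.
have -> (r : seq (multinom 3)) (c : multinom 3 -> R) : form_of (2 * k)
    (\sum_(m <- r) (c m)%:P *: mon R (m i0) (m i1)) =
    \sum_(m <- r) c m *: form_of (2 * k) (mon R (m i0) (m i1)).
  elim: r => [|m r IH]; last by rewrite !big_cons form_of_linear IH.
  by rewrite !big_nil; apply: val_inj; rewrite /= /homog_mpoly homog0.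
rewrite big_seq; elim/big_rec: _ => [|m w' mp Ow]; first by exists 0; rewrite ?scale0r ?addr0.
apply: OD => //; set c := mcoeff _ _; have mk := msupp_mdeg mp.
have [a1 [b1 [am bm h1 h2]]] : exists a1 b1,
    [/\ (a1 <= m i0)%N, (b1 <= m i1)%N, (a1 + b1 <= k)%N & (m i0 - a1 + (m i1 - b1) <= k)%N].
  exists (minn (m i0) k), (minn (m i1) (k - m i0)); split; lia.
set A := mon R a1 b1; set B := mon R (m i0 - a1) (m i1 - b1).
have AB : mon R (m i0) (m i1) = A * B by rewrite monM !subnKC.
have dA : tdeg k A by apply: tdeg_mon.
have dB : tdeg k B by apply: tdeg_mon.
have key s : s ^+ 2 = 1 -> (2%:R * s) *: form_of (2 * k) (A * B) =
    form_sqr (form_of k (s%:P *: A + B)) - (form_sqr (form_of k A) + form_sqr (form_of k B)).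
  move=> s2; rewrite -!form_of_sqr //; last by apply: tdegD => //; apply: tdegCZ.
  have -> : (s%:P *: A + B) ^+ 2 = (2%:R * s)%:P *: (A * B) + ((s ^+ 2)%:P *: A ^+ 2 + B ^+ 2).
    by rewrite -!mul_polyC polyC_exp !polyCM [2%:R%:P]rmorph_nat; ring.
  by rewrite !form_of_linear s2 scale1r addrK.
(* Two copies of [unit_sos], one to absorb A^2 and one B^2, which also covers A = B. *)
have pm s : s ^+ 2 = 1 -> sos_cone (2%:R *: unit_sos + (2%:R * s) *: form_of (2 * k) (A * B)).
  move=> s2; rewrite key // scaler_nat mulr2n.
  have := CD _ _ (form_sqr_sos (form_of k (s%:P *: A + B))) (CD _ _ (rest _ _ h1) (rest _ _ h2)).
  by congr sos_cone; rewrite -/A -/B addrACA -opprD addrCA.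
exists `|c| => //; rewrite AB.
have scaled s : s ^+ 2 = 1 -> `|c| * s = c ->
    sos_cone (`|c| *: unit_sos + c *: form_of (2 * k) (A * B)).
  move=> s2 cs; have c2 : 0 <= `|c| / 2%:R by rewrite divr_ge0.
  have := CZ _ _ c2 (pm s s2).
  by rewrite scalerDr !scalerA mulrA divfK ?pnatr_eq0 // cs.
have [c0|c0] := leP 0 c.
  by apply: (scaled 1); rewrite ?expr1n ?mulr1 ?ger0_norm.
by apply: (scaled (-1)); rewrite ?sqrrN ?expr1n ?mulrN1 ?ltr0_norm ?opprK.
Qed.

End SosCone.
End Forms.

Import VectorInternalTheory.

(** * From the algebraic core to the topological interior *)

Section Interior.
Variables (R : realType) (k : nat) (C : set (ternary_form R k)) (q : ternary_form R k).
Hypotheses (coneC : convex_cone C) (Cq : C q)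
  (core : forall f, exists2 eps, 0 < eps & C (q + eps *: f)).

(** In finite dimension it suffices to have room in the directions of a basis and their opposites: a
    small box around [q] consists of means of points on these segments. *)
Lemma core_interior : interior C q.
Proof.
have [CD CZ] := coneC; set N := dim (ternary_form R k).
pose b (i : 'I_N) : ternary_form R k :=
  @VectorInternalTheory.r2v R (ternary_form R k) (delta_mx 0 i).
have /choice[ep epP] : forall i : 'I_N, exists e, 0 < e /\ C (q + e *: b i).
  by move=> i; have [e e0 Ce] := core (b i); exists e.
have /choice[em emP] : forall i : 'I_N, exists e, 0 < e /\ C (q + e *: - b i).
  by move=> i; have [e e0 Ce] := core (- b i); exists e.
pose S := \sum_i ((ep i)^-1 + (em i)^-1).
have pos i : 0 <= (ep i)^-1 + (em i)^-1.
  by rewrite addr_ge0 // invr_ge0 ltW //; [case: (epP i)|case: (emP i)].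
have S0 : 0 <= S by apply: sumr_ge0.
(* The sum of the inverses gives an [eps] below every [ep i] and [em i]. *)
pose eps := (1 + S)^-1; have S1 : 0 < 1 + S by rewrite ltr_pwDl.
have eps0 : 0 < eps by rewrite invr_gt0.
have le i : (ep i)^-1 + (em i)^-1 <= 1 + S.
  rewrite /S (bigD1 i) //= addrCA lerDl addr_ge0 // sumr_ge0 //.
have shrink e t f : 0 < e -> C (q + e *: f) -> 0 <= t -> t <= e -> C (q + t *: f).
  move=> e0 Ce t0 te; have -> : q + t *: f = (1 - t / e) *: q + (t / e) *: (q + e *: f).
    by rewrite scalerDr scalerA divfK ?gt_eqF // addrA -scalerDl subrK scale1r.
  by apply: CD; apply: CZ => //; [rewrite subr_ge0 ler_pdivrMr ?mul1r|rewrite divr_ge0 // ltW].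
have seg i t : `|t| <= eps -> C (q + t *: b i).
  have [p0 Cp] := epP i; have [m0 Cm] := emP i.
  have lep : eps <= ep i.
    rewrite -[ep i]invrK lef_pV2 ?posrE ?invr_gt0 //; apply: le_trans (le i).
    by rewrite lerDl invr_ge0 ltW.
  have lem : eps <= em i.
    rewrite -[em i]invrK lef_pV2 ?posrE ?invr_gt0 //; apply: le_trans (le i).
    by rewrite lerDr invr_ge0 ltW.
  have [t0|t0] := leP 0 t.
    by rewrite ger0_norm // => te; apply: shrink Cp _ _ => //; apply: le_trans lep.
  rewrite ltr0_norm // => te; have -> : t *: b i = (- t) *: - b i by rewrite scalerN scaleNr opprK.
  by apply: shrink Cm _ _ => //; [rewrite oppr_ge0 ltW|apply: le_trans lem].
pose M : R := N.+1%:R; have M0 : 0 < M by rewrite ltr0n.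
have nb : nbhs q (@form_coord R k @^-1` ball (form_coord q) (eps / M)).
  apply: (@initial_continuous _ _ (@form_coord R k) q).
  by apply: nbhsx_ballx; rewrite divr_gt0.
rewrite /interior /=; apply: filterS nb => v /= vq.
have vqi i : `|form_coord v 0 i - form_coord q 0 i| <= eps / M.
  case: vq => _ /(_ 0 i); rewrite /ball /= distrC; exact: ltW.
have vE : v = q + \sum_i (form_coord v 0 i - form_coord q 0 i) *: b i.
  apply: (can_inj (@VectorInternalTheory.v2rK R (ternary_form R k))).
  rewrite raddfD raddf_sum /=; apply/rowP => j; rewrite mxE summxE (bigD1 j) //= big1 ?addr0.
    by rewrite linearZ_LR /= VectorInternalTheory.r2vK !mxE !eqxx mulr1 addrC subrK.
  move=> i ij; rewrite linearZ_LR /= VectorInternalTheory.r2vK !mxE eqxx [j == i]eq_sym.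
  by rewrite (negbTE ij) mulr0.
(* The mean of [q] and N points, each displaced from [q] along one basis vector; the factor [M]
   makes up for the averaging. *)
have -> : v = M^-1 *: q + \sum_i M^-1 *: (q + (M * (form_coord v 0 i - form_coord q 0 i)) *: b i).
  under eq_bigr => i _ do rewrite scalerDr scalerA mulKf ?gt_eqF //.
  rewrite big_split /= addrA sumr_const card_ord -mulrS -scaler_nat scalerA -/M.
  by rewrite mulfV ?gt_eqF // scale1r -vE.
have MV : 0 <= M^-1 by rewrite invr_ge0 ltW.
apply: (CD); first exact: CZ.
have C0 : C 0 by rewrite -(scale0r q); apply: CZ.
elim/big_rec: _ => // i w _ Cw; apply: CD => //; apply: CZ => //; apply: seg.
by rewrite normrM (gtr0_norm M0) mulrC -ler_pdivlMr.
Qed.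

End Interior.

Theorem corollary2p9 (R : realType) (d : nat) (p : ternary_form R (2 * d)) :
  strictly_positive p -> interior (@sos_cone R (2 * d)) (form_sqr p).
Proof.
move=> pos; set m := (2 * d)%N in p pos *.
have [Ce ou] := sos_cone_order_unit R m; have Cp := form_sqr_sos p.
apply: (core_interior (sos_cone_convex R m) Cp).
apply: (core_point (sos_cone_convex R m) ou Ce Cp) => phi lin phipos phip u.
pose L v := phi (form_of (2 * m) v).
have linL : functional L by move=> c v w; rewrite /L form_of_linear lin.
have psd v : tdeg m v -> 0 <= L (v ^+ 2).
  by move=> dv; rewrite /L form_of_sqr //; apply/phipos/form_sqr_sos.
have dp := tdeg_poly_of p.
have Lp : L (poly_of p ^+ 2) = 0 by rewrite /L form_of_sqr // poly_ofK.
have pL : psd_mod m m (poly_of p) L.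
  split => // v; have -> : (2 * m - m = m)%N by lia.
  move=> dv; apply: (psd_null linL) => // t; apply: psd.
  by apply: tdegD => //; apply: tdegCZ.
(* The extreme case n = m: [p] has half the degree in which [L] is defined. *)
have := vanish (leqnn m) dp (rootless_poly_of pos) pL (tdeg_poly_of u).
by rewrite /L poly_ofK.
Qed.
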